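(* Let $p\colon\mathbb{R}\to\mathbb{R}$ be a BPUC function. Assume that $x'=-x^2+p(t)$ has an attractor-repeller pair, and that $\Gamma\colon\mathbb{R}\to\mathbb{R}$ has finite asymptotic limits (at $\pm\infty$) and is $C^1$, nondecreasing, and nonconstant. Then the family of equations $$y'=-\big(y-c\,\Gamma(t)\big)^2+p(t),\qquad c\in\mathbb{R},$$ has exactly one tipping value $\hat c$, and it is strictly positive.
   Context: BPUC functions: a set $\Delta=\{a_j\mid j\in\mathbb{Z}\}\subset\mathbb{R}$ is disperse if $\inf_{j\in\mathbb{Z}}(a_{j+1}-a_j)>0$. $BPUC_\Delta(\mathbb{R},\mathbb{R})$ is the set of bounded right-continuous functions $q\colon\mathbb{R}\to\mathbb{R}$ such that for all $\varepsilon>0$ there is $\delta>0$ such that, if $t_1,t_2\in(a_j,a_{j+1})$ for some $j\in\mathbb{Z}$ and $|t_2-t_1|<\delta$, then $|q(t_2)-q(t_1)|<\varepsilon$. A function $q$ is BPUC if $q=q_1+\cdots+q_n$ with $q_i\in BPUC_{\Delta_i}(\mathbb{R},\mathbb{R})$ for finitely many disperse sets $\Delta_1,\dots,\Delta_n$. Solutions are in the Carathéodory sense (absolutely continuous on compact intervals, satisfying the equation a.e.); ''bounded solution'' means globally defined and bounded on $\mathbb{R}$. A bounded solution $\tilde b$ of $x'=-x^2+Q(t)x+P(t)$ is hyperbolic if there exist $k\ge1$, $\beta>0$ with either $\exp\int_s^t(-2\tilde b(l)+Q(l))\,dl\le k e^{-\beta(t-s)}$ whenever $t\ge s$ (attractive),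 or $\exp\int_s^t(-2\tilde b(l)+Q(l))\,dl\le k e^{\beta(t-s)}$ whenever $t\le s$ (repulsive). An attractor-repeller pair $(a,r)$ consists of the maximal bounded solution $a$ and the minimal bounded solution $r$ when they are hyperbolic, with $a$ attractive and $r$ repulsive. An equation is in Case A if it has two different hyperbolic solutions (equivalently, an attractor-repeller pair). A point $c_0\in\mathbb{R}$ is a tipping value for the family if the equation is in Case A for all $c$ in an open interval with endpoint $c_0$, but not for $c=c_0$. *)

(* Defs.v *)
From HB Require Import structures.
From mathcomp Require Import all_boot all_order all_algebra.
From mathcomp Require Import all_classical all_reals all_analysis.
From mathcomp Require Import ring.
Set Implicit Arguments.
Unset Strict Implicit.
Unset Printing Implicit Defensive.
Import Order.TTheory GRing.Theory Num.Theory.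
Import numFieldNormedType.Exports.
Local Open Scope classical_set_scope.
Local Open Scope ring_scope.

(** A disperse set [{a_j | j in Z}] is represented by its enumeration
    [a : int -> R].  If the gaps have no lower bound then [inf] is [0], so the
    condition fails, as it should. *)
Definition disperse (R : realType) (a : int -> R) : Prop :=
  0 < inf (range (fun j : int => a (j + 1) - a j)).

Definition BPUC_on (R : realType) (a : int -> R) (q : R -> R) : Prop :=
  [/\ bounded_fun q,
      right_continuous q &
      forall e : R, 0 < e -> exists2 d : R, 0 < d &
        forall (j : int) (t1 t2 : R),
          a j < t1 < a (j + 1) -> a j < t2 < a (j + 1) ->
          `|t2 - t1| < d -> `|q t2 - q t1| < e].

Definition BPUC (R : realType) (q : R -> R) : Prop :=
  exists (n : nat) (a : 'I_n.+1 -> int -> R) (qs : 'I_n.+1 -> R -> R),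
    [/\ forall i, disperse (a i),
        forall i, BPUC_on (a i) (qs i) &
        forall t, q t = \sum_(i < n.+1) qs i t].

Definition abs_continuous_on (R : realType) (u v : R) (f : R -> R) : Prop :=
  forall e : R, 0 < e -> exists2 d : R, 0 < d &
    forall (n : nat) (l r : 'I_n -> R),
      (forall i, [/\ u <= l i, l i <= r i & r i <= v]) ->
      trivIset setT (fun i => `]l i, r i[%classic) ->
      \sum_(i < n) (r i - l i) < d ->
      \sum_(i < n) `|f (r i) - f (l i)| < e.

(** The pair [(Q, P)] stands for the equation [x' = - x^2 + Q(t) x + P(t)]. *)
Definition quad_field (R : realType) (Q P : R -> R) (t x : R) : R :=
  - x ^+ 2 + Q t * x + P t.

(** Globally defined Caratheodory solution. *)
Definition solution (R : realType) (Q P : R -> R) (x : R -> R) : Prop :=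
  (forall u v : R, u <= v -> abs_continuous_on u v x) /\
  {ae (@lebesgue_measure R), forall t : R, is_derive t 1 x (quad_field Q P t (x t))}.

Definition bounded_solution (R : realType) (Q P : R -> R) (x : R -> R) : Prop :=
  solution Q P x /\ bounded_fun x.

(** Oriented integral from [s] to [t], also for [t < s]. *)
Definition oriented_integral (R : realType) (f : R -> R) (s t : R) : R :=
  if s <= t then \int[@lebesgue_measure R]_(l in `[s, t]) f l
  else - \int[@lebesgue_measure R]_(l in `[t, s]) f l.

Definition multiplier (R : realType) (Q b : R -> R) (s t : R) : R :=
  expR (oriented_integral (fun l => - 2 * b l + Q l) s t).

Definition attractive_hyperbolic (R : realType) (Q P b : R -> R) : Prop :=
  bounded_solution Q P b /\
  exists k beta : R, [/\ 1 <= k, 0 < beta &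
    forall s t : R, s <= t -> multiplier Q b s t <= k * expR (- beta * (t - s))].

Definition repulsive_hyperbolic (R : realType) (Q P b : R -> R) : Prop :=
  bounded_solution Q P b /\
  exists k beta : R, [/\ 1 <= k, 0 < beta &
    forall s t : R, t <= s -> multiplier Q b s t <= k * expR (beta * (t - s))].

Definition hyperbolic (R : realType) (Q P b : R -> R) : Prop :=
  attractive_hyperbolic Q P b \/ repulsive_hyperbolic Q P b.

Definition maximal_bounded_solution (R : realType) (Q P a : R -> R) : Prop :=
  bounded_solution Q P a /\
  forall x, bounded_solution Q P x -> forall t, x t <= a t.

Definition minimal_bounded_solution (R : realType) (Q P r : R -> R) : Prop :=
  bounded_solution Q P r /\
  forall x, bounded_solution Q P x -> forall t, r t <= x t.

Definition attractor_repeller_pair (R : realType) (Q P a r : R -> R) : Prop :=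
  [/\ maximal_bounded_solution Q P a, minimal_bounded_solution Q P r,
      attractive_hyperbolic Q P a & repulsive_hyperbolic Q P r].

Definition caseA (R : realType) (Q P : R -> R) : Prop :=
  exists b1 b2 : R -> R,
    [/\ hyperbolic Q P b1, hyperbolic Q P b2 & b1 <> b2].

(** Coefficients of [y' = - (y - c Gamma(t))^2 + p(t)]; see [shifted_fieldE]. *)
Definition shifted_Q (R : realType) (Gamma : R -> R) (c : R) : R -> R :=
  fun t => 2 * (c * Gamma t).

Definition shifted_P (R : realType) (Gamma p : R -> R) (c : R) : R -> R :=
  fun t => p t - (c * Gamma t) ^+ 2.

Lemma shifted_fieldE (R : realType) (Gamma p : R -> R) (c t y : R) :
  quad_field (shifted_Q Gamma c) (shifted_P Gamma p c) t y =
  - (y - c * Gamma t) ^+ 2 + p t.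
Proof. by rewrite /quad_field /shifted_Q /shifted_P; ring. Qed.

(** [Q] and [P] are families of coefficients indexed by the parameter [c]. *)
Definition tipping_value (R : realType) (Q P : R -> R -> R) (c0 : R) : Prop :=
  ~ caseA (Q c0) (P c0) /\
  ((exists2 c1 : R, c0 < c1 & forall c, c0 < c < c1 -> caseA (Q c) (P c)) \/
   (exists2 c1 : R, c1 < c0 & forall c, c1 < c < c0 -> caseA (Q c) (P c))).

(* Main.v *)
Require Import Defs.
From HB Require Import structures.
From mathcomp Require Import all_boot all_order all_algebra.
From mathcomp Require Import all_classical all_reals all_analysis.
From mathcomp Require Import measurable_realfun.
From mathcomp Require Import ring lra.
Import Order.TTheory GRing.Theory Num.Theory.
Import numFieldNormedType.Exports.
Local Open Scope classical_set_scope.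
Local Open Scope ring_scope.

(** Put [x = y - c Gamma].  The equation becomes [x' = - x^2 + p - c Gamma'], and as
    [Gamma' >= 0] its right-hand side decreases with [c].  Let [S] be the set of the
    parameters in Case A.  The proof shows that [S] contains [0], is downward
    closed, is open to the right, and is bounded above; hence [S] is the open
    half-line below [chat = sup S], and [chat > 0] is the only tipping value
    ([unique_tipping_value]).

    The parameter [0] is the given attractor-repeller pair.  The other properties
    rest on one comparison principle ([riccati_solution_above]): above a
    bounded subsolution there is a bounded entire solution.  A solution above,
    or only slightly below, an attractor inherits its exponential contraction,
    because the rate [2 x] increases with [x].  So, to keep an attractor when [c]
    changes, it suffices to build a subsolution close to it.  When [c] decreases,
    the old attractor is one ([has_attractor_le]).  When [c] increases a little,
    the old attractor is lowered by a small multiple of [v exp Gamma], where [v] is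
    the bounded solution of the linearized equation with forcing [1]; the
    exponential factor absorbs [Gamma'], which may be unbounded
    ([has_attractor_open]).  For large [c] no bounded solution exists: the bounded
    solutions have a bound independent of [c >= 0], while [c Gamma] makes a jump
    proportional to [c] between two fixed times
    ([attractor_parameter_bounded]).  Repellers are attractors of the
    time-reversed equation, which belongs to the same class.

    The forcing [p] is only piecewise continuous and solutions are meant almost
    everywhere.  This is removed once and for all by a bounded Lipschitz
    function [q] with [q' = p - g] almost everywhere, [g] continuous and bounded
    ([forcing_splitting]): an absolutely continuous [y] is a solution exactly when
    [y - q] is a classical solution of an equation with continuous coefficients
    ([bounded_solutionE]).  The key is that an absolutely continuous function whose
    derivative vanishes almost everywhere is constant
    ([abs_continuous_derive0_eq]). *)

(** * Derivatives and bounds *)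

Section Calculus.
Context {R : realType}.
Implicit Types (f g df dg : R -> R) (a b s t : R).

Definition bounded (f : R -> R) := exists B, forall t, `|f t| <= B.

Lemma is_derive_add {f g t a b} :
  is_derive t 1 f a -> is_derive t 1 g b ->
  is_derive t 1 (fun x => f x + g x) (a + b).
Proof. exact: is_deriveD. Qed.

Lemma is_derive_sub {f g t a b} :
  is_derive t 1 f a -> is_derive t 1 g b ->
  is_derive t 1 (fun x => f x - g x) (a - b).
Proof. exact: is_deriveB. Qed.

Lemma is_derive_opp {f t a} :
  is_derive t 1 f a -> is_derive t 1 (fun x => - f x) (- a).
Proof. exact: is_deriveN. Qed.

Lemma is_derive_mul {f g t a b} :
  is_derive t 1 f a -> is_derive t 1 g b ->
  is_derive t 1 (fun x => f x * g x) (a * g t + f t * b).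
Proof.
by move=> fa gb; have := is_deriveM fa gb; rewrite /GRing.scale/= addrC [g t * a]mulrC.
Qed.

Lemma is_derive_scale {f t a} (k : R) :
  is_derive t 1 f a -> is_derive t 1 (fun x => k * f x) (k * a).
Proof. exact: is_deriveZ. Qed.

Lemma is_derive_expR_comp {f t a} :
  is_derive t 1 f a -> is_derive t 1 (fun x => expR (f x)) (expR (f t) * a).
Proof. by move=> fa; apply: is_derive1_comp. Qed.

Lemma is_derive_const (k t : R) : is_derive t 1 (fun=> k : R) 0.
Proof. exact: is_derive_cst. Qed.

Lemma is_derive_lin (k t : R) : is_derive t 1 (fun x => k * x) k.
Proof.
by apply: is_derive_eq; rewrite ?/GRing.scale/= mulr1.
Qed.

Lemma is_derive_shiftr {f t a} (k : R) :
  is_derive (t + k) 1 f a -> is_derive t 1 (fun x => f (x + k)) a.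
Proof.
move=> fa; have sh : is_derive t 1 (fun x : R => x + k) (1 + 0).
  exact: (is_derive_add (f := id) (is_derive_id _ _) (is_derive_const _ _)).
by have := is_derive1_comp (g := fun x => x + k) fa sh; rewrite addr0 mulr1.
Qed.

Lemma is_derive_flip {f t a} :
  is_derive (- t) 1 f a -> is_derive t 1 (fun x => f (- x)) (- a).
Proof.
by move=> fa; rewrite -mulrN1; exact: (is_derive1_comp (g := fun x => - x)).
Qed.

Lemma is_derive_continuous {f df} :
  (forall t, is_derive t 1 f (df t)) -> continuous f.
Proof.
move=> fd t; apply: differentiable_continuous; apply/derivable1_diffP.
by have := fd t.
Qed.

Lemma continuous_add {f g} : continuous f -> continuous g ->
  continuous (fun t => f t + g t).
Proof. by move=> fc gc t; apply: cvgD; [exact: fc|exact: gc]. Qed.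

Lemma continuous_opp {f} : continuous f -> continuous (fun t => - f t).
Proof. by move=> fc t; apply: cvgN; exact: fc. Qed.

Lemma continuous_mul {f g} : continuous f -> continuous g ->
  continuous (fun t => f t * g t).
Proof. by move=> fc gc t; apply: cvgM; [exact: fc|exact: gc]. Qed.

Lemma continuous_scale {f} (k : R) : continuous f ->
  continuous (fun t => k * f t).
Proof. by move=> fc t; apply: cvgMr; exact: fc. Qed.

Lemma continuous_flip (f : R -> R) : continuous f -> continuous (fun t => f (- t)).
Proof.
move=> fc t; apply: (@continuous_comp _ _ _ (fun u : R => - u) f t); last exact: fc.
exact: oppr_continuous.
Qed.

Lemma le_of_is_derive {f df a b} : (forall t, is_derive t 1 f (df t)) ->
  a <= b -> (forall t, a <= t <= b -> 0 <= df t) -> f a <= f b.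
Proof.
move=> fd ab df0.
have fc : {within `[a, b], continuous f}.
  by apply: continuous_subspaceT => x; exact: is_derive_continuous.
have [c cab] := MVT_segment ab (fun x _ => fd x) fc.
rewrite -subr_ge0 => ->; apply: mulr_ge0; last by rewrite subr_ge0.
by apply: df0; move: cab; rewrite in_itv.
Qed.

Lemma lipschitz_of_is_derive {f df} (C : R) : (forall t, is_derive t 1 f (df t)) ->
  (forall t, `|df t| <= C) -> forall s t, `|f t - f s| <= C * `|t - s|.
Proof.
move=> fd dfC.
have le_case s t : s <= t -> `|f t - f s| <= C * `|t - s|.
  move=> st; rewrite (ger0_norm (_ : 0 <= t - s)) ?subr_ge0// ler_norml.
  have upper : f s + C * (t - s) >= f t.
    have fu (u : R) : is_derive u 1 (fun x => C * x - f x) (C - df u).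
      exact: (is_derive_sub (is_derive_lin C u) (fd u)).
    have := le_of_is_derive fu st; rewrite /= => H.
    suff : C * s - f s <= C * t - f t by lra.
    by apply: H => u _; rewrite subr_ge0 (le_trans (ler_norm _)).
  have lower : f s - C * (t - s) <= f t.
    have fu (u : R) : is_derive u 1 (fun x => f x + C * x) (df u + C).
      exact: (is_derive_add (fd u) (is_derive_lin C u)).
    have := le_of_is_derive fu st; rewrite /= => H.
    suff : f s + C * s <= f t + C * t by lra.
    by apply: H => u _; have := dfC u; rewrite ler_norml; lra.
  by apply/andP; split; lra.
move=> s t; have [/le_case//|/ltW/le_case] := leP s t.
by rewrite distrC [`|s - t|]distrC.
Qed.

Lemma continuous_lipschitz {f} (C : R) :
  (forall s t, `|f t - f s| <= C * `|t - s|) -> continuous f.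
Proof.
move=> fC t; apply/cvgrPdist_lt => e e0.
have C0 : 0 < `|C| + 1 by rewrite ltr_wpDl.
have := @cvgr_dist_lt _ _ _ (nbhs t) _ id t cvg_id (e / (`|C| + 1)).
rewrite divr_gt0// => /(_ _ isT); apply: filterS => s /=.
rewrite ltr_pdivlMr// => /(le_lt_trans _); apply.
apply: (le_trans (fC _ _)); rewrite mulrC ler_wpM2l//.
by rewrite (le_trans (ler_norm _))// lerDl.
Qed.

Lemma bounded_add (f g : R -> R) : bounded f -> bounded g ->
  bounded (fun t => f t + g t).
Proof.
by move=> [B fB] [C gC]; exists (B + C) => t; rewrite (le_trans (ler_normD _ _))// lerD.
Qed.

Lemma bounded_opp (f : R -> R) : bounded f -> bounded (fun t => - f t).
Proof. by move=> [B fB]; exists B => t; rewrite normrN. Qed.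

Lemma bounded_mul (f g : R -> R) : bounded f -> bounded g ->
  bounded (fun t => f t * g t).
Proof.
by move=> [B fB] [C gC]; exists (B * C) => t; rewrite normrM ler_pM.
Qed.

Lemma bounded_const (k : R) : bounded (fun=> k).
Proof. by exists `|k|. Qed.

Lemma bounded_common {f g : R -> R} : bounded f -> bounded g ->
  exists B, [/\ 0 <= B, forall t, `|f t| <= B & forall t, `|g t| <= B].
Proof.
move=> [B fB] [C gC]; exists (Num.max B C); split.
- by rewrite (le_trans (normr_ge0 (f 0)))// le_max fB.
- by move=> t; rewrite le_max fB.
- by move=> t; rewrite le_max gC orbT.
Qed.

Lemma near_is_derive0 (f : R -> R) (t e : R) : is_derive t 1 f 0 -> 0 < e ->
  \forall x \near t, `|f x - f t| <= e * `|x - t|.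
Proof.
move=> [fd dE] e0.
have /cvgrPdist_le/(_ e e0) : h^-1 *: (f (h *: 1 + t) - f t) @[h --> 0^'] --> (0 : R).
  by rewrite -[X in _ --> X]dE; exact: fd.
move=> /nbhs_ballP[r /= r0 rP]; apply/nbhs_ballP; exists r => //= x tx.
have [->|xt] := eqVneq x t; first by rewrite !subrr normr0 mulr0.
have xt0 : x - t != 0 by rewrite subr_eq0.
have := rP (x - t); rewrite /ball/= sub0r normrN distrC => /(_ tx xt0).
rewrite sub0r normrN /GRing.scale/= mulr1 subrK normrM normrV ?unitfE//.
by rewrite mulrC ler_pdivrMr ?normr_gt0// (distrC t).
Qed.

(** Applied to [f - d x], the first-order expansion contradicts monotonicity to
    the right of [t] when [d < 0]. *)
Lemma is_derive_nondecreasing_ge0 (f : R -> R) (t d : R) :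
  {homo f : s t / s <= t} -> is_derive t 1 f d -> 0 <= d.
Proof.
move=> fmono fd; rewrite leNgt; apply/negP => d0.
have hd := is_derive_sub fd (is_derive_lin d t); rewrite subrr in hd.
have e0 : 0 < - d / 2 by lra.
have /nbhs_ballP[r /= r0 rP] := near_is_derive0 _ _ _ hd e0.
have r20 : 0 < r / 2 by lra.
have tr : t <= t + r / 2 by lra.
have dist : t + r / 2 - t = r / 2 by ring.
have := rP (t + r / 2); rewrite /ball/= distrC dist gtr0_norm// => /(_ ltac:(lra)).
move=> /(le_trans (ler_norm _)).
have := fmono _ _ tr; nra.
Qed.

Lemma bounded_of_limits (G : R -> R) (gm gp : R) :
  {homo G : s t / s <= t} ->
  G t @[t --> -oo] --> gm -> G t @[t --> +oo] --> gp -> bounded G.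
Proof.
move=> Gmono /cvgrPdist_lt/(_ 1 ltr01) [a [_ am]] /cvgrPdist_lt/(_ 1 ltr01) [b [_ bp]].
exists (`|gm| + `|gp| + 1) => t.
have low s : s < a -> gm - 1 <= G t.
  move=> sa; have [ts|st] := leP t s.
    have := am t (le_lt_trans ts sa); rewrite /= ltr_norml; lra.
  by have := am s sa; have := Gmono _ _ (ltW st); rewrite /= ltr_norml; lra.
have up s : b < s -> G t <= gp + 1.
  move=> bs; have [st|ts] := leP s t.
    have := bp t (lt_le_trans bs st); rewrite /= ltr_norml; lra.
  by have := bp s bs; have := Gmono _ _ (ltW ts); rewrite /= ltr_norml; lra.
have := low (a - 1) ltac:(lra); have := up (b + 1) ltac:(lra).
have := ler_norm gp; have := ler_norm (- gm); rewrite normrN.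
have := normr_ge0 gm; have := normr_ge0 gp.
by rewrite ler_norml => *; apply/andP; split; lra.
Qed.

End Calculus.

(** * Primitives *)

Section Primitive.
Context {R : realType}.
Notation mu := (@lebesgue_measure R).

Lemma oriented_integralB (f : R -> R) :
  (forall a b : R, mu.-integrable `[a, b] (EFin \o f)) ->
  forall a b : R, a <= b ->
  oriented_integral f 0 b - oriented_integral f 0 a = \int[mu]_(x in `[a, b]) f x.
Proof.
move=> intf.
have chasles (a x b : R) : a <= x -> x <= b ->
    \int[mu]_(t in `[a, b]) f t - \int[mu]_(t in `[a, x]) f t =
    \int[mu]_(t in `[x, b]) f t.
  move=> ax xb; rewrite (Rintegral_itvB (intf a b)) ?bnd_simp//.
  rewrite Rintegral_itv_obnd_cbnd//.
  by apply: integrableS (intf x b) => //; exact: subset_itv_oc_cc.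
move=> a b ab; rewrite /oriented_integral.
have [a0|a0] := leP 0 a; first by rewrite (le_trans a0 ab) chasles.
have [b0|b0] := leP 0 b.
  by rewrite opprK -(chasles a 0 b (ltW a0) b0) subrK.
by rewrite opprK addrC -(chasles a b 0 ab (ltW b0)) opprB addrC subrK.
Qed.

(** The fundamental theorem of calculus keeps the left end of the integral
    fixed below the point; near [x] the oriented integral differs by a constant
    from the integral started at [x - 1]. *)
Lemma is_derive_oriented_integral (f : R -> R) (x : R) :
  (forall a b : R, mu.-integrable `[a, b] (EFin \o f)) ->
  lebesgue_pt f x -> is_derive x 1 (oriented_integral f 0) (f x).
Proof.
move=> intf fx.
pose a := x - 1.
have [] := @FTC1_lebesgue_pt R f (BLeft a) x (x + 1) _ (intf _ _) _ fx.
- by rewrite ltrDl.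
- by rewrite lte_fin /a gtrBl.
move=> dI eI.
have DI : is_derive x 1 (fun y : R => \int[mu]_(t in `[a, y]) f t
                                   + oriented_integral f 0 a) (f x + 0).
  refine (is_derive_add _ (is_derive_const _ _)).
  by apply: DeriveDef; [exact: dI|rewrite -derive1E; exact: eI].
rewrite addr0 in DI.
apply: near_eq_is_derive DI; near=> y.
have ay : a <= y by apply/ltW; near: y; apply: lt_nbhsr; rewrite gtrBl.
by rewrite -oriented_integralB// subrK.
Unshelve. all: by end_near. Qed.

Lemma continuous_integrable (f : R -> R) : continuous f ->
  forall a b : R, mu.-integrable `[a, b] (EFin \o f).
Proof.
move=> fc a b; apply: continuous_compact_integrable.
  exact: segment_compact.
exact: continuous_subspaceT.
Qed.

Lemma is_derive_oriented_integral_continuous (f : R -> R) : continuous f ->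
  forall t : R, is_derive t 1 (oriented_integral f 0) (f t).
Proof.
move=> fc t; apply: is_derive_oriented_integral.
  exact: continuous_integrable.
apply: (@continuous_lebesgue_pt R f t setT) => //.
- by split => //; exact: openT.
- exact: continuous_measurable_fun.
- exact: fc.
Qed.

Lemma continuous_primitive (f : R -> R) : continuous f ->
  exists F, forall t : R, is_derive t 1 F (f t).
Proof.
by exists (oriented_integral f 0) => t; exact: is_derive_oriented_integral_continuous.
Qed.

Lemma oriented_integral_is_derive (f F : R -> R) : continuous f ->
  (forall t : R, is_derive t 1 F (f t)) ->
  forall s t : R, oriented_integral f s t = F t - F s.
Proof.
move=> fc Fd.
have le_case (s t : R) : s <= t -> \int[mu]_(x in `[s, t]) f x = F t - F s.
  move=> st; rewrite -oriented_integralB//; last exact: continuous_integrable.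
  have Hd u := is_derive_sub (is_derive_oriented_integral_continuous _ fc u) (Fd u).
  have : `|(oriented_integral f 0 t - F t) - (oriented_integral f 0 s - F s)|
         <= 0 * `|t - s|.
    by apply: (lipschitz_of_is_derive 0 Hd) => u; rewrite subrr normr0.
  rewrite mul0r normr_le0 => /eqP; lra.
move=> s t; rewrite /oriented_integral; case: leP => [/le_case//|/ltW/le_case->].
by rewrite opprB.
Qed.

(** Sampling [f] at the next point of the grid of mesh [1 / (n + 1)] gives a
    function that is constant on countably many intervals; right-continuity
    makes these samples converge to [f] pointwise. *)
Lemma right_continuous_measurable (f : R -> R) :
  right_continuous f -> measurable_fun setT f.
Proof.
move=> frc.
pose grid (n : nat) (k : int) : R := k%:~R / n.+1%:R.
pose next (n : nat) (x : R) : R := grid n (Num.floor (x * n.+1%:R) + 1).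
have n0 n : 0 < n.+1%:R :> R by rewrite ltr0n.
refine (@measurable_fun_cvg _ R R setT (fun n x => f (next n x)) f _ _).
  move=> n _ Y mY; rewrite setTI.
  pose cell (k : int) : set R := if pselect (Y (f (grid n (k + 1)))) is left _
    then `[grid n k, grid n (k + 1)[%classic else set0.
  rewrite (_ : _ @^-1` _ = \bigcup_k cell k).
    apply: countable_bigcupT_measurable => //= k.
    by rewrite /cell; case: pselect.
  have cellP (x : R) k : grid n k <= x < grid n (k + 1) <->
      Num.floor (x * n.+1%:R) = k.
    rewrite /grid ler_pdivrMr// ltr_pdivlMr//; split; first exact: floor_def.
    by move=> <-; exact: floor_itv.
  apply/seteqP; split=> x /=.
    move=> Yx; exists (Num.floor (x * n.+1%:R)) => //.
    rewrite /cell; case: pselect => [_|//].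
    by rewrite /= in_itv/=; exact/cellP.
  move=> [k _]; rewrite /cell; case: pselect => //= Yk.
  by rewrite in_itv/= => /cellP; rewrite /next => ->.
move=> x _; move: (frc x) => /cvg_at_rightP; apply.
have next_gt n : x < next n x.
  by rewrite /next /grid ltr_pdivlMr//; have /andP[] := floor_itv (x * n.+1%:R).
have next_le n : next n x <= x + n.+1%:R^-1.
  rewrite /next /grid ler_pdivrMr// mulrDl mulVf ?gt_eqF// intrD lerD2r.
  by have /andP[] := floor_itv (x * n.+1%:R).
split=> //.
apply: (@squeeze_cvgr _ _ _ _ (fun=> x) (fun n => x + n.+1%:R^-1)).
- by apply: nearW => n; rewrite ltW//= next_le.
- exact: cvg_cst.
- by rewrite -[X in _ --> X]addr0; apply: cvgD; [exact: cvg_cst|exact: cvg_harmonic].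
Qed.

(** Almost every point is a Lebesgue point, so that continuity of [f] can be
    replaced by measurability at the price of an exceptional null set. *)
Lemma lipschitz_primitive (f : R -> R) (B : R) :
  measurable_fun setT f -> (forall t, `|f t| <= B) ->
  exists F : R -> R, (forall s t, `|F t - F s| <= B * `|t - s|) /\
    {ae mu, forall t : R, is_derive t 1 F (f t)}.
Proof.
move=> mf fB.
have intK (K : set R) : measurable K -> (mu K < +oo)%E ->
    mu.-integrable K (EFin \o f).
  move=> mK Kfin; apply: measurable_bounded_integrable => //.
    exact: measurable_funTS.
  exists B; split; first exact: num_real.
  by move=> x Bx y _ /=; rewrite (le_trans (fB y))// ltW.
have intf (a b : R) : mu.-integrable `[a, b] (EFin \o f).
  apply: intK => //; rewrite lebesgue_measure_itv/=.
  by case: ifP => // _; rewrite ltry.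
exists (oriented_integral f 0); split.
  have le_case (s t : R) : s <= t ->
      `|oriented_integral f 0 t - oriented_integral f 0 s| <= B * `|t - s|.
    move=> st; rewrite oriented_integralB//.
    apply: (le_trans (le_normr_Rintegral _ (intf s t))) => //.
    have -> : B * `|t - s| = \int[mu]_(x in `[s, t]) (fun=> B) x.
      have -> : \int[mu]_(x in `[s, t]) (fun=> B) x = B * fine (mu `[s, t]%classic).
        exact: Rintegral_cst.
      rewrite lebesgue_measure_itv/= lte_fin.
      move: st; rewrite le_eqVlt => /predU1P[->|st].
        by rewrite subrr normr0 ltxx.
      by rewrite st/= gtr0_norm ?subr_gt0.
    apply: le_Rintegral => //.
    - exact: integrable_norm.
    - apply: continuous_integrable; exact: cst_continuous.
  move=> s t; have [/le_case//|/ltW/le_case] := leP s t.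
  by rewrite distrC [`|s - t|]distrC.
have locf : locally_integrable setT f.
  split => //; first exact: openT.
  move=> K _ Kc.
  have mK : measurable K := compact_measurable Kc.
  by have /integrableP[] := intK _ mK (compact_finite_measure Kc).
move/lebesgue_differentiation: locf; apply: filterS.
  exact: (ae_filter_ringOfSetsType mu).
by move=> x; exact: is_derive_oriented_integral.
Qed.

End Primitive.

(** * Exponential dichotomies of scalar linear equations *)

Section Dichotomy.
Context {R : realType}.
Implicit Types (f g alpha : R -> R).

(** The scalar equation [z' = - alpha z] contracts forward in time at rate
    [beta], up to the factor [exp kappa].  The integral of [alpha] is replaced by
    an increment of a primitive, which serves both time directions at once. *)
Definition dichotomy (beta kappa : R) (alpha : R -> R) := exists A : R -> R,
  (forall t : R, is_derive t 1 A (alpha t)) /\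
  (forall s t, s <= t -> beta * (t - s) - kappa <= A t - A s).

Definition dichotomic alpha := exists beta kappa : R,
  0 < beta /\ dichotomy beta kappa alpha.

Lemma dichotomic_const (K : R) : 0 < K -> dichotomic (fun=> K).
Proof.
move=> K0; exists K, 0; split=> //; exists (fun t => K * t); split=> [t|s t _].
  exact: is_derive_lin.
by lra.
Qed.

(** The difference of two solutions of a Riccati equation solves the linear
    equation whose coefficient is the average of the two linearizations. *)
Lemma dichotomic_average alpha1 alpha2 : dichotomic alpha1 -> dichotomic alpha2 ->
  dichotomic (fun t => (alpha1 t + alpha2 t) / 2).
Proof.
move=> [b1 [k1 [b10 [A1 [A1d A1b]]]]] [b2 [k2 [b20 [A2 [A2d A2b]]]]].
exists ((b1 + b2) / 2), ((k1 + k2) / 2); split; first by lra.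
exists (fun t => 2^-1 * (A1 t + A2 t)); split=> [t|s t st].
  rewrite mulrC; exact: (is_derive_scale _ (is_derive_add (A1d t) (A2d t))).
by have := A1b _ _ st; have := A2b _ _ st; lra.
Qed.

(** With [A] a primitive of [alpha], [exp A * D] is nondecreasing.  A negative
    value of [D] would then propagate backward, amplified by [exp (- A)], which
    grows exponentially as time decreases. *)
Lemma dichotomic_comparison alpha D dD : dichotomic alpha ->
  (forall t : R, is_derive t 1 D (dD t)) -> bounded D ->
  (forall t, 0 <= dD t + alpha t * D t) -> forall t, 0 <= D t.
Proof.
move=> [beta [kappa [beta0 [A [Ad Ab]]]]] Dd [B DB] Dsup t.
rewrite leNgt; apply/negP => Dt.
have ED (u : R) : is_derive u 1 (fun x => expR (A x) * D x)
    (expR (A u) * alpha u * D u + expR (A u) * dD u).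
  exact: (is_derive_mul (is_derive_expR_comp (Ad u)) (Dd u)).
have mono s : s <= t -> expR (A s) * D s <= expR (A t) * D t.
  move=> st; apply: (le_of_is_derive ED st) => u _.
  by rewrite -mulrA -mulrDr mulr_ge0 ?expR_ge0// addrC.
have B0 : 0 <= B by rewrite (le_trans _ (DB 0)).
(* After going back by [T], the amplification factor exceeds [B / - D t]. *)
pose T := (kappa + B / - D t) / beta.
pose s := t - Num.max 0 T.
have st : s <= t by rewrite /s lerBlDr lerDl le_max lexx.
have Ats : B / - D t <= A t - A s.
  apply: le_trans (Ab _ _ st); rewrite lerBrDr addrC -ler_pdivrMl// mulrC.
  rewrite -/T /s opprB addrC subrK.
  by rewrite le_max lexx orbT.
have := mono _ st; rewrite -ler_pdivlMl ?expR_gt0// -expRN mulrA -expRD.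
rewrite leNgt => /negP; apply.
have e1 := expR_ge1Dx (- A s + A t).
have : B < expR (- A s + A t) * - D t.
  rewrite -ltr_pdivrMr ?oppr_gt0//; apply: lt_le_trans e1.
  by apply: (le_lt_trans Ats); lra.
have := DB s; rewrite ler_norml => /andP[+ _]; lra.
Qed.

(** The solution is the variation of constants formula started at minus
    infinity, [exp (- A t)] times the integral of [exp A * g] over [(-oo, t]].  With
    [Phi] a primitive of [exp A * g], the improper integral is [Phi - L] where [L]
    is the limit of [Phi] at minus infinity; it is obtained without a limit, as
    the number separating [Phi - c exp A] from [Phi + c exp A]. *)
Lemma dichotomic_bounded_solution alpha g :
  dichotomic alpha ->
  continuous g -> bounded g ->
  exists2 v, bounded v & forall t : R, is_derive t 1 v (- alpha t * v t + g t).
Proof.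
move=> [beta [kappa [beta0 [A [Ad Ab]]]]] gc [C gC].
have C0 : 0 <= C by rewrite (le_trans _ (gC 0)).
pose E t := expR (A t).
have Ed (t : R) : is_derive t 1 E (E t * alpha t) by exact: is_derive_expR_comp.
have [Phi Phid] : exists F, forall t : R, is_derive t 1 F (E t * g t).
  apply: (continuous_primitive (fun t => E t * g t)) => t.
  by apply: continuousM; [exact: (is_derive_continuous Ed)|exact: gc].
pose c := C * expR kappa / beta.
have half (sg : R) s t : `|sg| <= 1 -> s <= t ->
    sg * Phi t - sg * Phi s <= c * E t.
  move=> sg1 st.
  (* The added term is a primitive of a majorant of [|E * g|] on [(-oo, t]]. *)
  pose Psi x := c * E t * expR (beta * x - beta * t) - sg * Phi x.
  have Psid (u : R) : is_derive u 1 Psi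
      (c * E t * (expR (beta * u - beta * t) * (beta - 0)) - sg * (E u * g u)).
    exact: (is_derive_sub (is_derive_scale (c * E t) (is_derive_expR_comp
      (is_derive_sub (is_derive_lin beta u) (is_derive_const (beta * t) u))))
      (is_derive_scale sg (Phid u))).
  have : Psi s <= Psi t.
    apply: (le_of_is_derive Psid st) => u /andP[_ ut].
    rewrite subr_ge0.
    have Eu : E u <= expR kappa * E t * expR (beta * u - beta * t).
      by rewrite /E -!expRD ler_expR; have := Ab _ _ ut; lra.
    apply: (@le_trans _ _ (C * E u)).
      apply: (le_trans (ler_norm _)); rewrite normrM normrM (ger0_norm (expR_ge0 _)).
      rewrite mulrA mulrC ler_pM ?mulr_ge0 ?expR_ge0//.
      by rewrite ler_piMl ?expR_ge0.
    apply: (le_trans (ler_wpM2l C0 Eu)); rewrite le_eqVlt /c subr0.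
    by apply/orP; left; apply/eqP; field; rewrite gt_eqF.
  rewrite /Psi subrr expR0 mulr1 => le1.
  have : 0 <= c * E t * expR (beta * s - beta * t).
    by rewrite /c !mulr_ge0 ?expR_ge0 ?invr_ge0// ltW.
  by lra.
have c0 : 0 <= c by rewrite /c !mulr_ge0 ?expR_ge0 ?invr_ge0// ltW.
have cE t : 0 <= c * E t by rewrite mulr_ge0 ?expR_ge0.
have sandwich s t : Phi t - c * E t <= Phi s + c * E s.
  have [st|/ltW ts] := leP s t.
    have := half 1 s t; rewrite normr1 => /(_ (lexx _) st).
    by have := cE s; lra.
  have := half (-1) t s; rewrite normrN normr1 => /(_ (lexx _) ts).
  by have := cE t; lra.
pose lows := range (fun t => Phi t - c * E t).
have lowsub s : ubound lows (Phi s + c * E s) by move=> _ [t _ <-].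
have hs : has_sup lows.
  split; first by exists (Phi 0 - c * E 0); exists 0.
  by exists (Phi 0 + c * E 0).
pose L := sup lows.
have Ll t : Phi t - c * E t <= L by apply: sup_ubound => //; [case: hs|exists t].
have Lu t : L <= Phi t + c * E t.
  apply: sup_le_ub; first by case: hs.
  exact: lowsub.
exists (fun t => expR (- A t) * (Phi t - L)).
  exists c => t; rewrite normrM (ger0_norm (expR_ge0 _)).
  rewrite mulrC expRN ler_pdivrMr ?expR_gt0// ler_norml.
  by have := Ll t; have := Lu t; rewrite -/(E t) => l1 l2; apply/andP; split; lra.
move=> t.
have /(is_derive_mul (is_derive_expR_comp (is_derive_opp (Ad t)))) :=
  is_derive_sub (Phid t) (is_derive_const L t).
congr (is_derive _ _ _ _).
rewrite subr0 mulrA /E -expRD addNr expR0 mul1r; ring.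
Qed.

Lemma dichotomy_perturb (beta kappa delta : R) (a b : R -> R) :
  dichotomy beta kappa a -> continuous b ->
  (forall t, a t - delta <= b t) -> dichotomy (beta - delta) kappa b.
Proof.
move=> [A [Ad Ab]] bc ab; have [B Bd] := continuous_primitive b bc.
exists B; split=> // s t st; have := Ab _ _ st.
have Dd (u : R) := is_derive_sub (Bd u)
  (is_derive_sub (Ad u) (is_derive_lin delta u)).
have := le_of_is_derive Dd st; rewrite /= => H.
suff : B s - (A s - delta * s) <= B t - (A t - delta * t) by lra.
by apply: H => u _; have := ab u; lra.
Qed.

(** The second hypothesis bounds the increment of a primitive of [a] above by
    [kappa - beta (t - s)]; over a long interval this contradicts the first. *)
Lemma dichotomic_flip_false (a : R -> R) :
  dichotomic a -> dichotomic (fun t => - a (- t)) -> False.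
Proof.
move=> [b1 [k1 [b10 [A [Ad Ab]]]]] [b2 [k2 [b20 [B [Bd Bb]]]]].
pose T := (`|k1| + `|k2| + 1) / (b1 + b2).
have b12 : 0 < b1 + b2 by rewrite addr_gt0.
have T0 : 0 <= T by rewrite divr_ge0 ?addr_ge0// ltW.
have Hd (t : R) := is_derive_sub (Ad t) (is_derive_flip (Bd (- t))).
have Hlip := lipschitz_of_is_derive 0 Hd _ 0 T.
have : `|(A T - B (- T)) - (A 0 - B (- 0))| <= 0 * `|T - 0|.
  by apply: Hlip => t; rewrite !opprK subrr normr0.
rewrite mul0r normr_le0 oppr0 => /eqP AB.
have NT : - T <= 0 by rewrite oppr_le0.
have := Ab _ _ T0; have := Bb _ _ NT; rewrite subr0 sub0r opprK => h1 h2.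
have : (b1 + b2) * T = `|k1| + `|k2| + 1.
  by rewrite /T mulrC divfK// gt_eqF.
have := ler_norm k1; have := ler_norm k2; lra.
Qed.

End Dichotomy.

(** * Bounded solutions of Riccati equations *)

Section Riccati.
Context {R : realType}.

(** For [K] large, [H t w = K w - (w + h t)^2 + g t] is nondecreasing in [w] on a
    band [[-M, M]] that contains [l], and the bounded solutions in the band are the
    fixed points of the monotone operator that sends [w] to the bounded solution
    [v] of [v' = - K v + H t (w t)].  As in the Knaster-Tarski theorem, the
    supremum of the functions [w >= l] lying below their image is a fixed point.
    All images share a Lipschitz constant; asking it of the functions [w] makes
    the supremum continuous, so that the operator applies to it. *)
Lemma riccati_solution_above (h g l dl : R -> R) :
  continuous h -> bounded h -> continuous g -> bounded g ->
  bounded l -> (forall t : R, is_derive t 1 l (dl t)) ->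
  (forall t, dl t <= - (l t + h t) ^+ 2 + g t) ->
  exists w : R -> R, [/\ bounded w, forall t, l t <= w t &
    forall t : R, is_derive t 1 w (- (w t + h t) ^+ 2 + g t)].
Proof.
move=> hc hb gc gb lb ld lsub.
have [B0 [B00 hB0 gB0]] := bounded_common hb gb.
have [B [B_ge0 hB gB lB]] : exists B, [/\ 0 <= B, forall t, `|h t| <= B,
    forall t, `|g t| <= B & forall t, `|l t| <= B].
  have [C lC] := lb; exists (Num.max B0 C); split.
  - by rewrite le_max B00.
  - by move=> t; rewrite le_max hB0.
  - by move=> t; rewrite le_max gB0.
  - by move=> t; rewrite le_max lC orbT.
(* [(M - B) ^ 2 >= B] makes the constant [M] a supersolution. *)
pose M := 2 * B + 1.
pose K := 2 * (M + B).
have M0 : 0 <= M by rewrite /M; lra.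
have K0 : 0 < K by rewrite /K /M; lra.
pose H t w := K * w + (- (w + h t) ^+ 2 + g t).
have hb2 t : - B <= h t <= B by rewrite -ler_norml.
have gb2 t : - B <= g t <= B by rewrite -ler_norml.
have lb2 t : - B <= l t <= B by rewrite -ler_norml.
have Hmono t x y : - M <= x -> x <= y -> y <= M -> H t x <= H t y.
  move=> Mx xy yM; rewrite /H; have /andP[h1 h2] := hb2 t.
  have : 0 <= (y - x) * (K - (x + h t) - (y + h t)).
    by apply: mulr_ge0; rewrite /K; lra.
  nra.
have HM t : H t M <= K * M.
  rewrite /H; have /andP[h1 h2] := hb2 t; have /andP[g1 g2] := gb2 t.
  have : (B + 1) * (B + 1) <= (M + h t) * (M + h t).
    by apply: ler_pM; rewrite /M; lra.
  rewrite -expr2 -expr2 => hh; suff: B <= (B + 1) ^+ 2 by lra.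
  nra.
pose C := K * M + (M + B) ^+ 2 + B.
have C0 : 0 <= C by rewrite /C; apply: addr_ge0 => //; apply: addr_ge0; nra.
have HC t w : - M <= w <= M -> `|H t w| <= C.
  move=> /andP[w1 w2]; have /andP[h1 h2] := hb2 t; have /andP[g1 g2] := gb2 t.
  rewrite /H /C ler_norml.
  have : (w + h t) ^+ 2 <= (M + B) ^+ 2.
    rewrite -ler_sqrt ?sqr_ge0// !sqrtr_sqr (ger0_norm (_ : 0 <= M + B)); last by lra.
    by rewrite ler_norml; apply/andP; split; lra.
  by have sq := sqr_ge0 (w + h t) => sle; apply/andP; split; nra.
pose lip (w : R -> R) := forall s t, `|w t - w s| <= 2 * C * `|t - s|.
pose band (w : R -> R) := forall t, - M <= w t <= M.
pose next (w v : R -> R) := bounded v /\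
  forall t : R, is_derive t 1 v (- K * v t + H t (w t)).
have nextP w : continuous w -> band w -> exists v, next w v.
  move=> wc wM.
  have [v vb vd] : exists2 v, bounded v &
      forall t : R, is_derive t 1 v (- K * v t + H t (w t)).
    apply: (@dichotomic_bounded_solution _ (fun=> K) (fun t => H t (w t))).
    - exact: dichotomic_const.
    - apply: continuous_add; first exact: continuous_scale.
      apply: continuous_add => //; apply: continuous_opp.
      by apply: continuous_mul; apply: continuous_add.
    - by exists C => t; exact: HC.
  by exists v.
have next_mono w1 v1 w2 v2 : next w1 v1 -> next w2 v2 ->
    (forall t, H t (w1 t) <= H t (w2 t)) -> forall t, v1 t <= v2 t.
  move=> [v1b v1d] [v2b v2d] H12 t; rewrite -subr_ge0.
  apply: (dichotomic_comparison (fun=> K) (fun t => v2 t - v1 t) _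
    (dichotomic_const _ K0) (fun t => is_derive_sub (v2d t) (v1d t))).
    by apply: bounded_add => //; exact: bounded_opp.
  by move=> u; have := H12 u; rewrite /=; lra.
have next_le w v : band w -> next w v -> forall t, v t <= M.
  move=> wM [vb vd] t; rewrite -subr_ge0.
  apply: (dichotomic_comparison (fun=> K) (fun t => M - v t) _
    (dichotomic_const _ K0) (fun t => is_derive_sub (is_derive_const M t) (vd t))).
    by apply: bounded_add; [exact: bounded_const|exact: bounded_opp].
  move=> u /=; have /andP[w1 w2] := wM u.
  by have := HM u; have := Hmono u (w u) M w1 w2 (lexx _); lra.
have next_lip w v : band w -> next w v -> band v -> lip v.
  move=> wM [vb vd] vM; apply: (lipschitz_of_is_derive _ vd) => t.
  rewrite mulr2n mulrDl mul1r (le_trans (ler_normD _ _))// lerD ?HC//.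
  rewrite normrM normrN (ger0_norm (ltW K0)).
  apply: (@le_trans _ _ (K * M)).
    by rewrite ler_pM2l// ler_norml.
  by rewrite /C -addrA lerDl addr_ge0// sqr_ge0.
have lc : continuous l := is_derive_continuous ld.
have lM : band l by move=> t; have := lb2 t; rewrite /M; lra.
have le_next_l v : next l v -> forall t, l t <= v t.
  move=> [vb vd] t; rewrite -subr_ge0.
  apply: (dichotomic_comparison (fun=> K) (fun t => v t - l t) _
    (dichotomic_const _ K0) (fun t => is_derive_sub (vd t) (ld t))).
    by apply: bounded_add => //; exact: bounded_opp.
  by move=> u; have := lsub u; rewrite /H /=; lra.
(* The functions in the band that lie below their image. *)
pose cand (w : R -> R) := [/\ forall t, l t <= w t, band w, lip w &
  exists2 v, next w v & forall t, w t <= v t].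
have band_above w : (forall t, l t <= w t) -> (forall t, w t <= M) -> band w.
  move=> lw wM t; rewrite wM andbT (le_trans _ (lw t))//.
  by have /andP[] := lM t.
have cand_next w v : (forall t, l t <= w t) -> continuous w -> band w ->
    next w v -> (forall t, w t <= v t) -> cand v.
  move=> lw wc wM wv wlev.
  have lv t : l t <= v t by apply: le_trans (lw t) _.
  have vM := band_above _ lv (next_le _ _ wM wv).
  have vlip := next_lip _ _ wM wv vM.
  have [v2 vv2] := nextP _ (continuous_lipschitz _ vlip) vM.
  split => //; exists v2 => //; apply: (next_mono _ _ _ _ wv vv2) => t.
  by apply: Hmono; [have /andP[] := wM t|exact: wlev|have /andP[] := vM t].
have [v0 lv0] := nextP _ lc lM.
have cand0 : cand v0.
  by apply: (cand_next l) => //; exact: le_next_l.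
pose vals t := [set w t | w in cand].
have hs t : has_sup (vals t).
  split; first by exists (v0 t); exists v0.
  by exists M => _ [w [_ wM _ _] <-]; have /andP[] := wM t.
pose y t := sup (vals t).
have y_ub w : cand w -> forall t, w t <= y t.
  by move=> cw t; apply: sup_ubound; [case: (hs t)|exists w].
have y_lub t x : (forall w, cand w -> w t <= x) -> y t <= x.
  by move=> H1; apply: sup_le_ub; [case: (hs t)|move=> _ [w cw <-]; exact: H1].
have ly t : l t <= y t.
  by apply: le_trans (y_ub _ cand0 t); case: cand0.
have yM : band y.
  apply: band_above => // t; apply: y_lub => w [_ wM _ _].
  by have /andP[] := wM t.
have ylip : lip y.
  have half s t : y t <= y s + 2 * C * `|t - s|.
    apply: y_lub => w cw; have := y_ub _ cw s; case: cw => _ _ wl _.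
    by have := wl s t; rewrite ler_norml; lra.
  move=> s t; rewrite ler_norml.
  have := half s t; have := half t s; rewrite [`|s - t|]distrC.
  by move=> h1 h2; apply/andP; split; lra.
have yc := continuous_lipschitz _ ylip.
have [v yv] := nextP _ yc yM.
have y_le_v t : y t <= v t.
  apply: y_lub => w cw; have wy := y_ub _ cw.
  case: cw => lw wM wl [u wu wleu].
  apply: (le_trans (wleu t)); apply: (next_mono _ _ _ _ wu yv) => x.
  by apply: Hmono; [have /andP[] := wM x|exact: wy|have /andP[] := yM x].
have cv : cand v by apply: (cand_next y).
have vy : v = y.
  by apply/funext => t; apply/le_anti; rewrite y_ub// y_le_v.
exists y; split=> //; first by exists M => t; rewrite ler_norml.
move=> t; have [_ /(_ t)] := yv; rewrite vy /H.
by congr (is_derive _ _ _ _); ring.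
Qed.

End Riccati.

(** * Attractors and their dependence on the parameter *)

Section Attractor.
Context {R : realType}.

(** In the variable [w = y - q], where [q' = p - g] almost everywhere, the
    equation [y' = - (y - c G)^2 + p] has continuous coefficients, and
    [x = w + (q - c G)] is [y - c G], whose double is the rate of the linearization
    along [w]. *)
Definition attractor (q g G : R -> R) (c : R) (w : R -> R) := [/\ bounded w,
  forall t : R, is_derive t 1 w (- (w t + (q t - c * G t)) ^+ 2 + g t) &
  dichotomic (fun t => 2 * (w t + (q t - c * G t)))].

Definition has_attractor q g G c := exists w, attractor q g G c w.

(** The difference of two attractors is a bounded solution of a linear equation
    with a dichotomy, hence it vanishes. *)
Lemma attractor_unique q g G c w1 w2 :
  attractor q g G c w1 -> attractor q g G c w2 -> w1 = w2.
Proof.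
move=> [b1 d1 D1] [b2 d2 D2].
have Dav := dichotomic_average _ _ D1 D2.
have le_half u v : bounded u -> bounded v ->
    (forall t : R, is_derive t 1 u (- (u t + (q t - c * G t)) ^+ 2 + g t)) ->
    (forall t : R, is_derive t 1 v (- (v t + (q t - c * G t)) ^+ 2 + g t)) ->
    dichotomic (fun t =>
      (2 * (v t + (q t - c * G t)) + 2 * (u t + (q t - c * G t))) / 2) ->
    forall t, u t <= v t.
  move=> ub vb ud vd Duv t; rewrite -subr_ge0.
  apply: (dichotomic_comparison _ (fun t => v t - u t) _ Duv
    (fun t => is_derive_sub (vd t) (ud t))).
    by apply: bounded_add => //; exact: bounded_opp.
  by move=> x; rewrite le_eqVlt; apply/orP; left; apply/eqP; field.
apply/funext => t; apply/le_anti/andP; split.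
  by apply: (le_half _ _ b1 b2 d1 d2); exact: dichotomic_average.
by apply: (le_half _ _ b2 b1 d2 d1); exact: dichotomic_average.
Qed.

Section Data.
Context {q g G dG : R -> R}.
Hypotheses (qc : continuous q) (qb : bounded q).
Hypotheses (gc : continuous g) (gb : bounded g).
Hypotheses (Gd : forall t : R, is_derive t 1 G (dG t)) (Gb : bounded G).
Hypothesis dG_ge0 : forall t, 0 <= dG t.

Let h_continuous (c : R) : continuous (fun t => q t - c * G t).
Proof.
apply: continuous_add => //; apply/continuous_opp/continuous_scale.
exact: is_derive_continuous.
Qed.

Let h_bounded (c : R) : bounded (fun t => q t - c * G t).
Proof.
apply: bounded_add => //; apply: bounded_opp.
by apply: bounded_mul => //; exact: bounded_const.
Qed.

(** A solution above a subsolution that is only slightly below an attractor, in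
    the variable [x], has almost the same contraction rate: hyperbolicity comes
    for free from the ordering. *)
Lemma has_attractor_of_subsolution (c c' beta kappa delta : R) (w l dl : R -> R) :
  dichotomy beta kappa (fun t => 2 * (w t + (q t - c * G t))) -> 2 * delta < beta ->
  bounded l -> (forall t : R, is_derive t 1 l (dl t)) ->
  (forall t, dl t <= - (l t + (q t - c' * G t)) ^+ 2 + g t) ->
  (forall t, w t + (q t - c * G t) - delta <= l t + (q t - c' * G t)) ->
  has_attractor q g G c'.
Proof.
move=> wD db lb ld lsub lw.
have [v [vb vl vd]] := riccati_solution_above (fun t => q t - c' * G t) g l dl
  (h_continuous c') (h_bounded c') gc gb lb ld lsub.
exists v; split=> //; exists (beta - 2 * delta), kappa; split; first by lra.
apply: (dichotomy_perturb _ _ _ _ _ wD).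
  apply: continuous_scale; apply: continuous_add => //.
  exact: is_derive_continuous vd.
by move=> t; have := lw t; have := vl t; lra.
Qed.

(** In the variable [x = y - c G] the equation is [x' = - x^2 + p - c G'], and its
    right-hand side decreases with [c] because [G' >= 0]: the attractor for [c] is
    a subsolution for every smaller parameter. *)
Lemma has_attractor_le (c c' : R) : c' <= c ->
  has_attractor q g G c -> has_attractor q g G c'.
Proof.
move=> cc' [w [wb wd [beta [kappa [beta0 wD]]]]].
apply: (has_attractor_of_subsolution c c' beta kappa 0 w
  (fun t => w t - (c - c') * G t) _ wD _ _
  (fun t => is_derive_sub (wd t) (is_derive_scale (c - c') (Gd t)))).
- by rewrite mulr0.
- apply: bounded_add => //; apply: bounded_opp.
  by apply: bounded_mul => //; exact: bounded_const.
- move=> t /=.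
  rewrite (_ : w t - _ + _ = w t + (q t - c * G t)); last by ring.
  by rewrite gerBl mulr_ge0// subr_ge0.
- by move=> t; lra.
Qed.

(** Lower the attractor by [u = eta v exp G], where [v] is the bounded solution of
    [v' = - 2 x v + 1].  Then [u' = - 2 x u + eta exp G + G' u]: the second term
    absorbs the quadratic error [u^2] when [eta] is small, and the third one
    absorbs [e G'] when [e <= u], even if [G'] is unbounded. *)
Lemma has_attractor_open (c : R) : has_attractor q g G c ->
  exists2 e : R, 0 < e & has_attractor q g G (c + e).
Proof.
move=> [w [wb wd [beta [kappa [beta0 wD]]]]].
pose x t := w t + (q t - c * G t).
have xb : bounded x by exact: bounded_add.
have [X xX] := xb.
have X0 : 0 <= X by rewrite (le_trans _ (xX 0)).
have xdich : dichotomic (fun t => 2 * x t) by exists beta, kappa.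
have [v [V vV] vd] : exists2 v, bounded v &
    forall t : R, is_derive t 1 v (- (2 * x t) * v t + 1).
  apply: (dichotomic_bounded_solution _ (fun=> 1) xdich).
    exact: cst_continuous.
  exact: bounded_const.
have V0 : 0 <= V by rewrite (le_trans _ (vV 0)).
(* The constant [m] is a subsolution of the equation of [v]. *)
pose m := (2 * X + 1)^-1.
have X1 : 0 < 2 * X + 1 by lra.
have m0 : 0 < m by rewrite invr_gt0.
have vm t : m <= v t.
  rewrite -subr_ge0.
  apply: (dichotomic_comparison _ (fun t => v t - m) _ xdich
    (fun t => is_derive_sub (vd t) (is_derive_const m t))).
    apply: bounded_add; [by exists V|exact: bounded_const].
  move=> u /=; have := xX u; rewrite ler_norml => /andP[x1 x2].
  suff : 2 * x u * m <= 1 by lra.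
  by rewrite /m ler_pdivrMr//; lra.
have [Bg GB] := Gb.
have Gbd t : - Bg <= G t <= Bg by rewrite -ler_norml.
pose e0 := expR (- Bg); pose e1 := expR Bg.
have e0_gt0 : 0 < e0 := expR_gt0 _.
have e1_gt0 : 0 < e1 := expR_gt0 _.
have eG t : e0 <= expR (G t) <= e1.
  by rewrite /e0 /e1 !ler_expR.
(* [n1] ensures [u ^ 2 <= eta * exp G] and [n2] ensures [u <= beta / 8]. *)
pose n1 := (V ^+ 2 * e1 + 1)^-1; pose n2 := beta / (8 * (V * e1 + 1)).
have d1 : 0 < V ^+ 2 * e1 + 1.
  by rewrite ltr_wpDl// mulr_ge0 ?sqr_ge0// ltW.
have d2 : 0 < V * e1 + 1 by rewrite ltr_wpDl// mulr_ge0// ltW.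
pose eta := Num.min n1 n2.
have eta0 : 0 < eta.
  by rewrite /eta lt_min invr_gt0 d1 divr_gt0// mulr_gt0.
have eta1 : eta * (V ^+ 2 * e1) <= 1.
  apply: (@le_trans _ _ (n1 * (V ^+ 2 * e1))).
    by rewrite ler_wpM2r ?ge_min ?lexx// mulr_ge0 ?sqr_ge0// ltW.
  by rewrite mulrC ler_pdivrMr// mul1r lerDl.
have eta2 : eta * (V * e1) <= beta / 8.
  apply: (@le_trans _ _ (n2 * (V * e1))).
    by rewrite ler_wpM2r ?ge_min ?lexx ?orbT// mulr_ge0// ltW.
  rewrite /n2 mulrAC ler_pdivrMr ?mulr_gt0//.
  rewrite (_ : beta / 8 * _ = beta * (V * e1) + beta); last by field.
  by rewrite lerDl ltW.
pose u t := eta * (v t * expR (G t)).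
have ud (t : R) := is_derive_scale eta
  (is_derive_mul (vd t) (is_derive_expR_comp (Gd t))).
pose e := eta * (m * e0).
have ue t : e <= u t.
  rewrite /e /u ler_pM2l//; have /andP[g1 _] := eG t.
  by apply: ler_pM => //; exact: ltW.
have v0 t : 0 < v t by apply: lt_le_trans (vm t).
have vleV t : v t <= V by rewrite (le_trans (ler_norm _)).
have u_small t : u t <= beta / 8.
  apply: le_trans eta2; rewrite /u ler_pM2l//.
  have /andP[_ g1] := eG t.
  by apply: ler_pM => //; exact: ltW.
have u_sqr t : u t ^+ 2 <= eta * expR (G t).
  rewrite (_ : u t ^+ 2 = eta * expR (G t) * (eta * (v t ^+ 2 * expR (G t)))).
    apply: ler_piMr; first by rewrite mulr_ge0 ?expR_ge0// ltW.
    apply: le_trans eta1; rewrite ler_pM2l//.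
    have /andP[_ g1] := eG t.
    apply: ler_pM => //; first exact: sqr_ge0.
    by rewrite !expr2; apply: ler_pM => //; exact: ltW.
  by rewrite /u; ring.
have e_gt0 : 0 < e by rewrite /e !mulr_gt0.
exists e => //.
apply: (has_attractor_of_subsolution c (c + e) beta kappa (beta / 8) w
  (fun t => (w t + e * G t) - u t) _ wD _ _
  (fun t => is_derive_sub (is_derive_add (wd t) (is_derive_scale e (Gd t))) (ud t))).
- by lra.
- apply: bounded_add.
    apply: bounded_add => //.
    by apply: bounded_mul => //; exact: bounded_const.
  apply: bounded_opp; exists (beta / 8) => t.
  by rewrite ger0_norm// (le_trans (ltW e_gt0)).
- move=> t /=.
  rewrite (_ : w t + _ - _ + _ = x t - u t); last by rewrite /x; ring.
  rewrite -/(x t).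
  have k1 : 0 <= dG t * (u t - e) by rewrite mulr_ge0// subr_ge0.
  have k2 := u_sqr t.
  have -> : eta * ((- (2 * x t) * v t + 1) * expR (G t) +
      v t * (expR (G t) * dG t)) =
      - 2 * x t * u t + eta * expR (G t) + u t * dG t by rewrite /u; ring.
  have -> : - (x t - u t) ^+ 2 = - x t ^+ 2 + 2 * x t * u t - u t ^+ 2 by ring.
  by lra.
- by move=> t; have := u_small t; lra.
Qed.

(** Above [m] the function decreases, hence backward in time it stays above [m]
    and grows at unit speed forever. *)
Lemma barrier_le (f df : R -> R) (m : R) : bounded f ->
  (forall t : R, is_derive t 1 f (df t)) ->
  (forall t, m < f t -> df t <= -1) -> forall t, f t <= m.
Proof.
move=> [B fB] fd drop t; rewrite leNgt; apply/negP => mt.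
have fc := is_derive_continuous fd.
have desc (a b : R) : a <= b -> (forall s, a <= s <= b -> m < f s) ->
    f b + (b - a) <= f a.
  move=> ab fm.
  have Hd (s : R) := is_derive_opp (is_derive_add (fd s) (is_derive_lin 1 s)).
  have := le_of_is_derive Hd ab; rewrite /= !mul1r => H.
  suff : - (f a + a) <= - (f b + b) by lra.
  by apply: H => s sab; have := drop _ (fm _ sab); lra.
have above s : s <= t -> f t <= f s.
  move=> st.
  (* If the maximum of [f] on [[s, t]] were not at [s], then [f] would be larger
     just before it. *)
  have [tau] := EVT_max st (continuous_subspaceT fc).
  rewrite in_itv/= => /andP[stau taut] taumax.
  have ft : f t <= f tau by apply: taumax; rewrite in_itv/= st lexx.
  move: stau; rewrite le_eqVlt => /predU1P[->//|stau]; exfalso.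
  have : \forall u \near tau, m < f u.
    exact: (cvgr_gt (f tau) (fc tau) _ (lt_le_trans mt ft)).
  move=> /nbhs_ballP[r /= r0 rm].
  pose a := Num.max s (tau - r / 2).
  have atau : a < tau by rewrite /a gt_max stau gtrBl divr_gt0.
  have : f tau + (tau - a) <= f a.
    apply: desc; first exact: ltW.
    move=> u /andP[au ut]; apply: rm; rewrite /ball/= ger0_norm ?subr_ge0//.
    by move: au; rewrite /a ge_max => /andP[_]; lra.
  have : f a <= f tau.
    apply: taumax; rewrite in_itv/= le_max lexx/=.
    by rewrite (le_trans (ltW atau)).
  by lra.
pose s := t - (2 * B + 1).
have B0 : 0 <= B by rewrite (le_trans _ (fB 0)).
have st : s <= t by rewrite /s; lra.
have := desc s t st (fun u su => lt_le_trans mt (above u (proj2 (andP su)))).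
have := fB s; have := fB t; rewrite !ler_norml /s; lra.
Qed.

(** For [c >= 0] the function [u = x - q] satisfies [u' <= - (u + q)^2 + g], which
    confines every bounded solution to [[-m, m]] with [m] independent of [c].  But
    [w = u + c G] grows at speed at most [B], so that the increment
    [c (G t - G s)] is bounded. *)
Lemma attractor_parameter_bounded (s t : R) : G s < G t ->
  exists C, forall c, has_attractor q g G c -> c <= C.
Proof.
move=> Gst.
have st : s <= t.
  rewrite leNgt; apply/negP => /ltW ts.
  have := le_of_is_derive Gd ts (fun u _ => dG_ge0 u); lra.
have [B [B0 qB gB]] := bounded_common qb gb.
pose m := 2 * B + 1.
pose C := (2 * m + B * (t - s)) / (G t - G s).
exists (Num.max 0 C) => c [w [wb wd _]].
have [c0|c0] := leP c 0; first by rewrite le_max c0.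
rewrite le_max; apply/orP; right.
pose u x := w x - c * G x.
have ud x := is_derive_sub (wd x) (is_derive_scale c (Gd x)).
have ub : bounded u.
  apply: bounded_add => //; apply: bounded_opp.
  by apply: bounded_mul => //; exact: bounded_const.
have far x : m < `|u x| ->
    - (w x + (q x - c * G x)) ^+ 2 + g x - c * dG x <= -1.
  move=> mu.
  have -> : w x + (q x - c * G x) = u x + q x by rewrite /u; ring.
  have : 0 <= c * dG x by rewrite mulr_ge0// ltW.
  have := gB x; rewrite ler_norml => /andP[g1 g2].
  have B1 : B + 1 <= `|u x + q x|.
    have := ler_normB (u x + q x) (q x); rewrite addrK.
    by have := qB x; move: mu; rewrite /m; lra.
  have : (B + 1) ^+ 2 <= (u x + q x) ^+ 2.
    rewrite -[(u x + q x) ^+ 2]real_normK ?num_real//.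
    by rewrite ler_sqr ?nnegrE//; lra.
  nra.
have u_le x : u x <= m.
  apply: (barrier_le _ _ _ ub ud) => y my; apply: far.
  by rewrite (lt_le_trans my)// ler_norm.
have u_ge x : - m <= u x.
  have vd y := is_derive_opp (is_derive_flip (ud (- y))).
  have := barrier_le _ _ m _ vd _ (- x); rewrite opprK => H.
  have : - u x <= m.
    apply: H; first by have [D uD] := ub; exists D => y; rewrite normrN; exact: uD.
    move=> y my; rewrite opprK; apply: far.
    by rewrite (lt_le_trans my)// -normrN ler_norm.
  lra.
have zd x := is_derive_sub (is_derive_lin B x) (wd x).
have := le_of_is_derive zd st; rewrite /= => H.
have : B * s - w s <= B * t - w t.
  apply: H => x _; have := gB x; rewrite ler_norml => /andP[_ g2].
  by have := sqr_ge0 (w x + (q x - c * G x)); lra.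
rewrite /C ler_pdivlMr ?subr_gt0//.
by have := u_le s; have := u_ge t; rewrite /u; lra.
Qed.

End Data.
End Attractor.

(** * Absolutely continuous functions *)

Section AbsContinuous.
Context {R : realType}.
Notation mu := (@lebesgue_measure R).

(** Absolute continuity transferred from families indexed by ordinals to lists,
    in which the intervals are ordered from right to left. *)
Lemma interval_family_sum_lt (u v e d : R) (f : R -> R) (s : seq (R * R)) :
  (forall (n : nat) (l r : 'I_n -> R),
      (forall i, [/\ u <= l i, l i <= r i & r i <= v]) ->
      trivIset setT (fun i => `]l i, r i[%classic) ->
      \sum_(i < n) (r i - l i) < d ->
      \sum_(i < n) `|f (r i) - f (l i)| < e) ->
  (forall I, I \in s -> [/\ u <= I.1, I.1 <= I.2 & I.2 <= v]) ->
  pairwise (fun I J : R * R => J.2 <= I.1) s ->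
  \sum_(I <- s) (I.2 - I.1) < d -> \sum_(I <- s) `|f I.2 - f I.1| < e.
Proof.
move=> fe sv /(pairwiseP (0, 0)) sdisj.
rewrite (big_nth (0, 0)) big_mkord => sd.
rewrite (big_nth (0, 0)) big_mkord.
apply: (fe _ (fun i => (nth (0, 0) s i).1) (fun i => (nth (0, 0) s i).2)) => //.
  by move=> i; apply: sv; exact: mem_nth.
move=> i j _ _ [x []]; rewrite /= !in_itv/= => /andP[il ir] /andP[jl jr].
have disj (a b : 'I_(size s)) : (a < b)%N -> (nth (0, 0) s a).1 < x ->
    x < (nth (0, 0) s b).2 -> False.
  move=> ab al br; have := sdisj a b (ltn_ord a) (ltn_ord b) ab.
  by rewrite leNgt (lt_trans al br).
have ij : ~~ (i < j)%N by apply/negP => ij; exact: (disj i j ij il jr).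
have ji : ~~ (j < i)%N by apply/negP => ji; exact: (disj j i ji jl ir).
by apply: ord_inj; case: ltngtP ij ji.
Qed.

(** Cover the exceptional null set by an open set [U] of measure less than [d].
    Each point has a neighbourhood on which either [f] varies at speed at most [e]
    or which lies in [U].  By compactness of [[u, v]], used in the form of a
    supremum of the points reached from [u], finitely many steps of these two kinds
    lead from [u] to [v]: those of the first kind contribute at most [e (v - u)], those
    of the second kind less than [e] by absolute continuity. *)
Lemma abs_continuous_derive0_eq (u v : R) (f : R -> R) : u <= v ->
  abs_continuous_on u v f -> {ae mu, forall t : R, is_derive t 1 f 0} ->
  f v = f u.
Proof.
move=> uv fac [N [mN N0 fN]].
suff small (e : R) : 0 < e -> `|f v - f u| <= e * (v - u) + e.
  apply/eqP; rewrite -subr_eq0 -normr_le0; apply/ler_addgt0Pl => e e0.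
  have k0 : 0 < v - u + 1 by rewrite ltr_wpDl// subr_ge0.
  have := small (e / (v - u + 1)); rewrite divr_gt0// => /(_ isT).
  rewrite addr0; congr (_ <= _).
  by field; rewrite gt_eqF.
move=> e0; have [d d0 fd] := fac e e0.
have [U [Uo NU Ud]] : exists U : set R, [/\ open U, N `<=` U & (mu U < d%:E)%E].
  have [|U [Uo NU UN]] := lebesgue_regularity_outer mN _ d0.
    exact: (eq_ind_r (fun x => (x < +oo)%E) (ltry 0) N0).
  exists U; split => //; apply: le_lt_trans UN.
  have mU := open_measurable Uo.
  rewrite -[leRHS]adde0 -N0 -measureU//; last 2 first.
  - exact: measurableD.
  - by apply/seteqP; split => x // [[]].
  apply: le_measure; rewrite ?inE//.
    by apply: measurableU => //; exact: measurableD.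
  by move=> x Ux; have [Nx|Nx] := pselect (N x); [right|left].
have mU := open_measurable Uo.
pose step (a b : R) := `|f b - f a| <= e * (b - a) \/ `[a, b[%classic `<=` U.
have local t : exists2 h : R, 0 < h &
    forall a b, t - h < a -> a <= t -> t <= b -> b < t + h -> step a b.
  have [Ut|Ut] := pselect (U t).
    have /nbhs_ballP[h /= h0 hU] : nbhs t U by apply: open_nbhs_nbhs.
    exists h => // a b ta at' tb bt; right => x /=; rewrite in_itv/= => /andP[ax xb].
    by apply: hU; rewrite /ball/= ltr_norml; apply/andP; split; lra.
  have tder : is_derive t 1 f 0.
    by apply: contrapT => nder; apply: Ut; apply: NU; exact: fN.
  have /nbhs_ballP[h /= h0 hU] := near_is_derive0 _ _ _ tder e0.
  exists h => // a b ta at' tb bt; left.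
  have := hU a; rewrite /ball/= ger0_norm ?subr_ge0// => /(_ _)/wrap[]; first lra.
  have := hU b; rewrite /ball/= ler0_norm ?subr_le0// => /(_ _)/wrap[]; first lra.
  rewrite (ger0_norm (_ : 0 <= b - t)) ?subr_ge0//.
  rewrite (ler0_norm (_ : a - t <= 0)) ?subr_le0//.
  have := ler_distD (f t) (f b) (f a); rewrite (distrC (f t)); lra.
(* [t] is reached from [u]; [s] lists the steps of the second kind. *)
pose chain t := exists s : seq (R * R), [/\
  forall I, I \in s -> [/\ u <= I.1, I.1 <= I.2 & I.2 <= t],
  pairwise (fun I J : R * R => J.2 <= I.1) s,
  ((\sum_(I <- s) (I.2 - I.1))%:E <= mu (U `&` `[u, t[))%E &
  `|f t - f u| <= e * (t - u) + \sum_(I <- s) `|f I.2 - f I.1|].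
have extend a b : u <= a -> a <= b -> chain a -> step a b -> chain b.
  move=> ua ab [s [su sdisj smu sf]] [fab|abU].
    exists s; split=> //.
    - by move=> I /su[I1 I2 I3]; split=> //; exact: le_trans ab.
    - apply: (le_trans smu); apply: le_measure; rewrite ?inE.
      + exact: measurableI.
      + exact: measurableI.
      + by apply: setIS; apply: subset_itvl; rewrite bnd_simp.
    - by have := ler_distD (f a) (f b) (f u); lra.
  exists ((a, b) :: s); split.
  - move=> I; rewrite in_cons => /predU1P[->//|/su[I1 I2 I3]].
    by split=> //; exact: le_trans ab.
  - by rewrite /= sdisj andbT; apply/allP => I /su[].
  - rewrite big_cons/= EFinD.
    have -> : (b - a)%:E = mu `[a, b[%classic.
      rewrite lebesgue_measure_itv/= lte_fin; case: ltP => // ba.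
      by congr EFin; lra.
    apply: (le_trans (leeD2l _ smu)).
    rewrite -measureU//; last 2 first.
    - exact: measurableI.
    - apply/seteqP; split=> x //= [] /[swap] -[_]; rewrite !in_itv/=.
      by move=> /andP[_ xa] /andP[ax _]; lra.
    apply: le_measure; rewrite ?inE.
    + by apply: measurableU => //; exact: measurableI.
    + exact: measurableI.
    + move=> x [abx|[Ux]].
        split; first exact: abU.
        by move: abx; rewrite /= !in_itv/= => /andP[ax ->]; rewrite (le_trans ua).
      rewrite /= !in_itv/= => /andP[ux xa]; split=> //=.
      by rewrite ux (lt_le_trans xa).
  - rewrite big_cons/=; have := ler_distD (f a) (f b) (f u).
    have : 0 <= e * (b - a) by rewrite mulr_ge0 ?subr_ge0// ltW.
    lra.
pose S := [set t | u <= t <= v /\ chain t].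
have Su : S u.
  split; first by rewrite lexx.
  by exists [::]; rewrite !big_nil !subrr normr0 mulr0 addr0; split=> //.
have Ssup : has_sup S.
  by split; [exists u|exists v => t [/andP[]]].
pose T := sup S.
have uT : u <= T by apply: sup_ubound => //; case: Ssup.
have Tv : T <= v by apply: sup_le_ub; [exists u|move=> t [/andP[]]].
have [h h0 hT] := local T.
have [t [/andP[ut tv] ct] Tt] := sup_adherent h0 Ssup.
have tT : t <= T by apply: sup_ubound; [case: Ssup|split=> //; rewrite ut tv].
pose b := Num.min v (T + h / 2).
have Tb : T <= b by rewrite /b le_min Tv lerDl ltW// divr_gt0.
have bT : b < T + h.
  by rewrite /b gt_min; apply/orP; right; lra.
have cb : chain b.
  by apply: (extend t) => //; [exact: le_trans Tb|exact: hT].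
have bv : b = v.
  apply/eqP; rewrite eq_le ge_min lexx/= leNgt; apply/negP => blt.
  have bE : b = T + h / 2.
    by move: blt; rewrite /b minEle; case: ifP => //; rewrite ltxx.
  have : b <= T.
    apply: sup_ubound; first by case: Ssup.
    by split=> //; rewrite (le_trans uT Tb) ltW.
  by rewrite bE; lra.
move: cb; rewrite bv => -[s [su sdisj smu sf]].
have sd : \sum_(I <- s) (I.2 - I.1) < d.
  rewrite -lte_fin (le_lt_trans smu)// (le_lt_trans _ Ud)//.
  by apply: le_measure; rewrite ?inE//; exact: measurableI.
have := interval_family_sum_lt u v e d f s fd su sdisj sd; lra.
Qed.

End AbsContinuous.

(** * Regularization of the forcing *)

Section Forcing.
Context {R : realType}.
Notation mu := (@lebesgue_measure R).

Lemma bounded_funE (f : R -> R) : bounded_fun f <-> bounded f.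
Proof.
split=> [[M [_ fM]]|[B fB]].
  by exists (M + 1) => t; apply: (fM (M + 1)); rewrite ?ltrDl.
exists B; split; first exact: num_real.
by move=> x Bx t _ /=; rewrite (le_trans (fB t))// ltW.
Qed.

Lemma bounded_sum (n : nat) (f : 'I_n -> R -> R) : (forall i, bounded (f i)) ->
  bounded (fun t => \sum_(i < n) f i t).
Proof.
move=> /choice[B fB]; exists (\sum_(i < n) B i) => t.
by apply: (le_trans (ler_norm_sum _ _ _)); apply: ler_sum => i _; exact: fB.
Qed.

Lemma BPUC_bounded_measurable (p : R -> R) : BPUC p ->
  bounded p /\ measurable_fun setT p.
Proof.
move=> [n [a [qs [_ qsP pE]]]].
have {pE} -> : p = fun t => \sum_(i < n.+1) qs i t by apply/funext.
split.
  by apply: bounded_sum => i; have [/bounded_funE] := qsP i.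
apply: measurable_sum => i; apply: right_continuous_measurable.
by have [] := qsP i.
Qed.

(** Subtracting from a Lipschitz primitive [F] of [p] its moving average
    [m t], the integral of [F] over [[t, t + 1]], leaves a bounded function [q], and
    the error [g = m'] is [F (t + 1) - F t], which is continuous and bounded. *)
Lemma forcing_splitting (p : R -> R) : BPUC p ->
  exists (q g : R -> R) (L : R), [/\ bounded q,
    forall s t, `|q t - q s| <= L * `|t - s|, continuous g, bounded g &
    {ae mu, forall t : R, is_derive t 1 q (p t - g t)}].
Proof.
move=> /BPUC_bounded_measurable[[B pB] mp].
have [F [Flip Fd]] := lipschitz_primitive p B mp pB.
have Fc := continuous_lipschitz B Flip.
have B0 : 0 <= B by rewrite (le_trans _ (pB 0)).
have [Psi Psid] := continuous_primitive F Fc.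
pose m (t : R) : R := Psi (t + 1) - Psi t.
pose g t := F (t + 1) - F t.
have md (t : R) : is_derive t 1 m (g t).
  exact: (is_derive_sub (is_derive_shiftr 1 (Psid (t + 1))) (Psid t)).
have gB t : `|g t| <= B.
  by rewrite (le_trans (Flip _ _))// addrAC subrr add0r normr1 mulr1.
have mlip := lipschitz_of_is_derive B md gB.
exists (fun t => F t - m t), g, (B + B); split.
- exists B => t.
  have Hd (x : R) := is_derive_sub (is_derive_lin (F t) x) (Psid x).
  have near_t x : t <= x <= t + 1 -> `|F t - F x| <= B.
    move=> tx; apply: (le_trans (Flip _ _)); rewrite ler_piMr// ler_norml; lra.
  have t1 : t <= t + 1 by rewrite lerDl.
  have up (x : R) := is_derive_add (Hd x) (is_derive_lin B x).
  have := le_of_is_derive up t1; rewrite /= => H1.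
  have lo (x : R) := is_derive_sub (is_derive_lin B x) (Hd x).
  have := le_of_is_derive lo t1; rewrite /= => H2.
  have {}H1 : F t * t - Psi t + B * t <= F t * (t + 1) - Psi (t + 1) + B * (t + 1).
    by apply: H1 => x /near_t; rewrite ler_norml; lra.
  have {}H2 : B * t - (F t * t - Psi t) <= B * (t + 1) - (F t * (t + 1) - Psi (t + 1)).
    by apply: H2 => x /near_t; rewrite ler_norml; lra.
  by rewrite ler_norml /m; apply/andP; split; lra.
- move=> s t; rewrite mulrDl.
  rewrite (_ : _ - _ - _ = (F t - F s) - (m t - m s)); last by ring.
  by rewrite (le_trans (ler_normB _ _))// lerD// (le_trans (Flip _ _)).
- apply: continuous_add; last exact: continuous_opp.
  apply: (continuous_lipschitz B) => s t.
  by rewrite (le_trans (Flip _ _))// opprD addrACA subrr addr0.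
- by exists B.
- move: Fd; apply: filterS; first exact: (ae_filter_ringOfSetsType mu).
  by move=> t Ft; exact: (is_derive_sub Ft (md t)).
Qed.

Lemma abs_continuous_lipschitz (C : R) (f : R -> R) (u v : R) :
  (forall s t, `|f t - f s| <= C * `|t - s|) -> abs_continuous_on u v f.
Proof.
move=> fC e e0; have C0 : 0 <= C.
  by have := fC 0 1; rewrite subr0 normr1 mulr1; apply: le_trans.
exists (e / (C + 1)); first by rewrite divr_gt0// ltr_wpDl.
move=> n l r lr _ small.
apply: (@le_lt_trans _ _ (C * \sum_(i < n) (r i - l i))).
  rewrite mulr_sumr; apply: ler_sum => i _; have [_ lri _] := lr i.
  by apply: (le_trans (fC _ _)); rewrite ger0_norm// subr_ge0.
rewrite ltr_pdivlMr ?ltr_wpDl// in small.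
apply: le_lt_trans small; rewrite mulrDr mulr1 mulrC lerDl.
by apply: sumr_ge0 => i _; rewrite subr_ge0; have [] := lr i.
Qed.

Lemma abs_continuous_sub (f g : R -> R) (u v : R) :
  abs_continuous_on u v f -> abs_continuous_on u v g ->
  abs_continuous_on u v (fun t => f t - g t).
Proof.
move=> fa ga e e0; have e20 : 0 < e / 2 by rewrite divr_gt0.
have [df df0 fP] := fa _ e20; have [dg dg0 gP] := ga _ e20.
exists (Num.min df dg); first by rewrite lt_min df0.
move=> n l r lr disj; rewrite lt_min => /andP[/(fP _ _ _ lr disj) hf].
move=> /(gP _ _ _ lr disj) hg.
apply: (@le_lt_trans _ _ (\sum_(i < n) (`|f (r i) - f (l i)| + `|g (r i) - g (l i)|))).
  apply: ler_sum => i _; rewrite (le_trans _ (ler_normB _ _))//.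
  by rewrite le_eqVlt; apply/orP; left; apply/eqP; congr `|_|; ring.
by rewrite big_split/=; lra.
Qed.

Lemma abs_continuous_continuous (f : R -> R) :
  (forall u v, u <= v -> abs_continuous_on u v f) -> continuous f.
Proof.
move=> fa t; apply/cvgrPdist_lt => e e0.
have [|d d0 dP] := fa (t - 1) (t + 1) _ e e0; first lra.
apply/nbhs_ballP; exists (Num.min d 1); first by rewrite /= lt_min d0 ltr01.
move=> s; rewrite /ball/= lt_min => /andP[sd s1].
have one (a b : R) : t - 1 <= a -> a <= b -> b <= t + 1 -> b - a < d ->
    `|f b - f a| < e.
  move=> ta ab bt bad; have := dP 1%N (fun=> a) (fun=> b).
  rewrite !big_ord1; apply=> //.
  by move=> i j _ _ _; rewrite !ord1.
move: s1; rewrite ltr_norml => s1.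
have [st|/ltW ts] := leP s t.
  by apply: one => //; [lra|lra|rewrite (le_lt_trans _ sd)// ler_norm].
rewrite distrC; apply: one => //; [lra|lra|].
by rewrite (le_lt_trans _ sd)// distrC ler_norm.
Qed.

End Forcing.

(** * Hyperbolic solutions as attractors *)

Section Translation.
Context {R : realType}.
Notation mu := (@lebesgue_measure R).
Context {p q g G dG : R -> R} {L : R}.
Hypotheses (qb : bounded q) (q_lip : forall s t, `|q t - q s| <= L * `|t - s|).
Hypotheses (gc : continuous g) (gb : bounded g).
Hypothesis q_derive : {ae mu, forall t : R, is_derive t 1 q (p t - g t)}.
Hypotheses (Gd : forall t : R, is_derive t 1 G (dG t)) (Gb : bounded G).

Let qc : continuous q := continuous_lipschitz L q_lip.
Let Gc : continuous G := is_derive_continuous Gd.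

(** In the variable [y - q] a Caratheodory solution is a classical one: its
    derivative exists almost everywhere and agrees there with a continuous
    function, so that it differs by a constant from a primitive of that
    function. *)
Lemma bounded_solutionE (c : R) (y : R -> R) :
  bounded_solution (shifted_Q G c) (shifted_P G p c) y <->
  bounded (fun t => y t - q t) /\ forall t : R,
    is_derive t 1 (fun t => y t - q t)
      (- ((y t - q t) + (q t - c * G t)) ^+ 2 + g t).
Proof.
have xE t (z : R) : (z - q t) + (q t - c * G t) = z - c * G t by ring.
have xb : bounded y -> bounded (fun t => - (y t - c * G t) ^+ 2 + g t).
  move=> yb; apply: bounded_add => //; apply: bounded_opp.
  have : bounded (fun t => y t - c * G t).
    apply: bounded_add => //; apply: bounded_opp.
    by apply: bounded_mul => //; exact: bounded_const.
  by move=> hb; apply: (bounded_mul _ _ hb hb).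
split.
  move=> [[yac yd] /bounded_funE yb]; split.
    by apply: bounded_add => //; exact: bounded_opp.
  have yc := abs_continuous_continuous _ yac.
  pose theta t := - (y t - c * G t) ^+ 2 + g t.
  have thc : continuous theta.
    apply: continuous_add => //; apply: continuous_opp.
    have hc : continuous (fun t => y t - c * G t).
      by apply: continuous_add => //; apply/continuous_opp/continuous_scale.
    exact: (continuous_mul hc hc).
  have [Y Thd] := continuous_primitive theta thc.
  have [C theta_le] := xb yb.
  have Y_lip := lipschitz_of_is_derive C Thd theta_le.
  have f_const (u v : R) : u <= v ->
      y v - q v - Y v = y u - q u - Y u.
    move=> uv.
    apply: (abs_continuous_derive0_eq u v (fun t => y t - q t - Y t) uv).
      apply: abs_continuous_sub.
        apply: abs_continuous_sub; first exact: yac.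
        exact: abs_continuous_lipschitz q_lip.
      exact: abs_continuous_lipschitz Y_lip.
    move: yd q_derive.
    apply: filterS2; first exact: (ae_filter_ringOfSetsType mu).
    move=> t ytd qtd; have := is_derive_sub (is_derive_sub ytd qtd) (Thd t).
    congr (is_derive _ _ _ _).
    by rewrite shifted_fieldE /theta; ring.
  have yE : (fun t => y t - q t) = (fun t => Y t + (y 0 - q 0 - Y 0)).
    apply/funext => t; have [t0|/ltW t0] := leP t 0.
      by have := f_const _ _ t0; lra.
    by have := f_const _ _ t0; lra.
  move=> t; rewrite xE yE -[X in is_derive _ _ _ X]addr0.
  exact: (is_derive_add (Thd t) (is_derive_const _ t)).
move=> [wb wd].
have yE : y = fun t => (y t - q t) + q t by apply/funext => t; rewrite subrK.
have yb : bounded y by rewrite yE; exact: bounded_add.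
have [C xC] := xb yb.
have wC t : `|- ((y t - q t) + (q t - c * G t)) ^+ 2 + g t| <= C.
  by rewrite xE.
have w_lip := lipschitz_of_is_derive C wd wC.
split; last exact/bounded_funE.
split.
  move=> u v _; apply: (abs_continuous_lipschitz (C + L)) => s t.
  rewrite mulrDl (_ : y t - y s = ((y t - q t) - (y s - q s)) + (q t - q s)).
    by rewrite (le_trans (ler_normD _ _))// lerD.
  by ring.
move: q_derive; apply: filterS; first exact: (ae_filter_ringOfSetsType mu).
move=> t qtd; rewrite [X in is_derive _ _ X _]yE.
have := is_derive_add (wd t) qtd; congr (is_derive _ _ _ _).
by rewrite shifted_fieldE xE; ring.
Qed.

Let x_continuous (c : R) (y : R -> R) : continuous y ->
  continuous (fun t => 2 * (y t - c * G t)).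
Proof.
move=> yc; apply: continuous_scale.
by apply: continuous_add => //; apply/continuous_opp/continuous_scale.
Qed.

Lemma multiplierE (c : R) (y A : R -> R) : continuous y ->
  (forall t : R, is_derive t 1 A (2 * (y t - c * G t))) ->
  forall s t, multiplier (shifted_Q G c) y s t = expR (A s - A t).
Proof.
move=> yc Ad s t; rewrite /multiplier.
have fE : (fun l => - 2 * y l + shifted_Q G c l) =
    fun t => - (2 * (y t - c * G t)).
  by apply/funext => u; rewrite /shifted_Q; ring.
have fc := continuous_opp (x_continuous c y yc).
rewrite fE (oriented_integral_is_derive _ _ fc (fun u => is_derive_opp (Ad u))).
by congr expR; ring.
Qed.

Lemma attractive_rateE (c : R) (y : R -> R) : continuous y ->
  (exists k beta : R, [/\ 1 <= k, 0 < beta & forall s t : R, s <= t ->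
     multiplier (shifted_Q G c) y s t <= k * expR (- beta * (t - s))]) <->
  dichotomic (fun t => 2 * (y t - c * G t)).
Proof.
move=> yc; split.
  move=> [k [beta [k1 beta0 kb]]].
  have [A Ad] := continuous_primitive _ (x_continuous c y yc).
  exists beta, (ln k); split=> //; exists A; split=> // s t st.
  have := kb _ _ st; rewrite (multiplierE _ _ _ yc Ad).
  rewrite -{1}(@lnK _ k) ?posrE ?(lt_le_trans ltr01)//.
  by rewrite -expRD ler_expR; lra.
move=> [beta [kappa [beta0 [A [Ad Ab]]]]].
exists (expR (Num.max 0 kappa)), beta; split=> //.
  by rewrite -expR0 ler_expR le_max lexx.
move=> s t st; rewrite (multiplierE _ _ _ yc Ad) -expRD ler_expR.
have := Ab _ _ st; have : kappa <= Num.max 0 kappa by rewrite le_max lexx orbT.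
lra.
Qed.

Lemma repulsive_rateE (c : R) (y : R -> R) : continuous y ->
  (exists k beta : R, [/\ 1 <= k, 0 < beta & forall s t : R, t <= s ->
     multiplier (shifted_Q G c) y s t <= k * expR (beta * (t - s))]) <->
  dichotomic (fun t => - (2 * (y (- t) - c * G (- t)))).
Proof.
move=> yc; split.
  move=> [k [beta [k1 beta0 kb]]].
  have [A Ad] := continuous_primitive _ (x_continuous c y yc).
  exists beta, (ln k); split=> //; exists (fun t => A (- t)); split=> [t|s t st].
    exact: (is_derive_flip (Ad (- t))).
  have ts : - t <= - s by rewrite lerN2.
  have := kb _ _ ts; rewrite (multiplierE _ _ _ yc Ad).
  rewrite -{1}(@lnK _ k) ?posrE ?(lt_le_trans ltr01)//.
  by rewrite -expRD ler_expR; lra.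
move=> [beta [kappa [beta0 [A [Ad Ab]]]]].
exists (expR (Num.max 0 kappa)), beta; split=> //.
  by rewrite -expR0 ler_expR le_max lexx.
have Bd (t : R) : is_derive t 1 (fun t => A (- t)) (2 * (y t - c * G t)).
  by have := is_derive_flip (Ad (- t)); rewrite !opprK.
move=> s t ts; rewrite (multiplierE _ _ _ yc Bd) -expRD ler_expR.
have st : - s <= - t by rewrite lerN2.
have := Ab _ _ st; have : kappa <= Num.max 0 kappa by rewrite le_max lexx orbT.
lra.
Qed.

Let solution_continuous (c : R) (y : R -> R) :
  bounded_solution (shifted_Q G c) (shifted_P G p c) y -> continuous y.
Proof. by move=> [[yac _] _]; exact: abs_continuous_continuous. Qed.

Lemma attractive_hyperbolicE (c : R) (y : R -> R) :
  attractive_hyperbolic (shifted_Q G c) (shifted_P G p c) y <->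
  attractor q g G c (fun t => y t - q t).
Proof.
have xE : (fun t => 2 * ((y t - q t) + (q t - c * G t))) =
    (fun t => 2 * (y t - c * G t)) by apply/funext => t; ring.
rewrite /attractor xE; split.
  move=> [ys yr]; have /bounded_solutionE[wb wd] := ys.
  by split=> //; apply/(attractive_rateE _ _ (solution_continuous _ _ ys)).
move=> [wb wd yD]; have ys : bounded_solution (shifted_Q G c) (shifted_P G p c) y.
  exact/bounded_solutionE.
by split=> //; apply/(attractive_rateE _ _ (solution_continuous _ _ ys)).
Qed.

(** Reversing time and changing sign, [y] becomes [- y (- t)] and solves an
    equation of the same family, with [p (- t)] for [p] and [- G (- t)] for [G], again
    nondecreasing; repulsive solutions become attractive ones. *)
Lemma repulsive_hyperbolicE (c : R) (y : R -> R) :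
  repulsive_hyperbolic (shifted_Q G c) (shifted_P G p c) y <->
  attractor (fun t => - q (- t)) (fun t => g (- t)) (fun t => - G (- t)) c
    (fun t => - (y (- t) - q (- t))).
Proof.
have xE : (fun t => 2 * (- (y (- t) - q (- t)) + (- q (- t) - c * - G (- t)))) =
    (fun t => - (2 * (y (- t) - c * G (- t)))) by apply/funext => t; ring.
rewrite /attractor xE; split.
  move=> [ys yr]; have /bounded_solutionE[[B wB] wd] := ys.
  split.
  - by exists B => t; rewrite normrN.
  - move=> t; have := is_derive_opp (is_derive_flip (wd (- t))).
    by congr (is_derive _ _ _ _); ring.
  - by apply/(repulsive_rateE _ _ (solution_continuous _ _ ys)).
move=> [[B wB] wd yD].
have ys : bounded_solution (shifted_Q G c) (shifted_P G p c) y.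
  apply/bounded_solutionE; split.
    by exists B => t; have := wB (- t); rewrite normrN opprK.
  move=> t; have := is_derive_opp (is_derive_flip (wd (- t))).
  have -> : (fun x => - - (y (- - x) - q (- - x))) = (fun x => y x - q x).
    by apply/funext => x; rewrite !opprK.
  by congr (is_derive _ _ _ _); rewrite !opprK; ring.
by split=> //; apply/(repulsive_rateE _ _ (solution_continuous _ _ ys)).
Qed.

(** Two attractors coincide, and so do two repellers; hence of two distinct
    hyperbolic solutions one is attractive and the other one is repulsive. *)
Lemma caseAE (c : R) :
  caseA (shifted_Q G c) (shifted_P G p c) <->
  has_attractor q g G c /\
  has_attractor (fun t => - q (- t)) (fun t => g (- t)) (fun t => - G (- t)) c.
Proof.
split.
  move=> [b1 [b2 [h1 h2 b12]]].
  case: h1 => [/attractive_hyperbolicE a1|/repulsive_hyperbolicE r1];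
  case: h2 => [/attractive_hyperbolicE a2|/repulsive_hyperbolicE r2].
  - exfalso; apply: b12; apply/funext => t.
    have /(congr1 (fun f => f t))/= := attractor_unique _ _ _ _ _ _ a1 a2.
    lra.
  - by split; [exists (fun t => b1 t - q t)|exists (fun t => - (b2 (- t) - q (- t)))].
  - by split; [exists (fun t => b2 t - q t)|exists (fun t => - (b1 (- t) - q (- t)))].
  - exfalso; apply: b12; apply/funext => t.
    have /(congr1 (fun f => f (- t)))/= := attractor_unique _ _ _ _ _ _ r1 r2.
    rewrite opprK; lra.
move=> [[w1 a1] [w2 a2]].
pose y1 t := w1 t + q t; pose y2 t := q t - w2 (- t).
have y1E : (fun t => y1 t - q t) = w1 by apply/funext => t; rewrite /y1 addrK.
have y2E : (fun t => - (y2 (- t) - q (- t))) = w2.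
  by apply/funext => t; rewrite /y2 opprK; ring.
exists y1, y2; split.
- by left; apply/attractive_hyperbolicE; rewrite y1E.
- by right; apply/repulsive_hyperbolicE; rewrite y2E.
- move=> y12; have [_ _ D1] := a1; have [_ _ D2] := a2.
  apply: (dichotomic_flip_false _ D1).
  congr dichotomic: D2; apply/funext => t.
  have := congr1 (fun f => f (- t)) y12; rewrite /y1 /y2 opprK; lra.
Qed.

End Translation.

(** * The tipping value *)

Section Tipping.
Context {R : realType}.

(** The parameters in Case A form an open half-line unbounded below; its endpoint
    is the only point outside it that bounds an interval of such parameters. *)
Lemma unique_tipping_value (Q P : R -> R -> R) :
  let S := [set c | caseA (Q c) (P c)] in
  S 0 -> (forall c c', c' <= c -> S c -> S c') ->
  (forall c, S c -> exists2 e : R, 0 < e & S (c + e)) ->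
  (exists C, ubound S C) ->
  exists chat : R, unique (tipping_value Q P) chat /\ 0 < chat.
Proof.
move=> S S0 Sdown Sopen [C SC].
have Ssup : has_sup S by split; [exists 0|exists C].
have le_sup c : S c -> c <= sup S by move=> Sc; apply: sup_ubound => //; case: Ssup.
have below c : c < sup S -> S c.
  move=> cS; have [|c' Sc' c'S] := @sup_adherent _ S (sup S - c) _ Ssup.
    by rewrite subr_gt0.
  by apply: Sdown Sc'; lra.
have notS : ~ S (sup S).
  by move=> /Sopen[e e0 /le_sup]; lra.
exists (sup S); split; last first.
  by have [e e0] := Sopen 0 S0; rewrite add0r => /le_sup; exact: lt_le_trans.
split.
  split=> //; right; exists (sup S - 1); first by lra.
  by move=> c /andP[_ /below].
move=> c0 [notSc0 Sc0]; apply/eqP; rewrite eq_le; apply/andP; split.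
  by rewrite leNgt; apply/negP => /below.
rewrite leNgt; apply/negP => c0S.
case: Sc0 => -[c1 c01 c1P].
  have : S ((c0 + c1) / 2) by apply: c1P; lra.
  by move=> /le_sup; lra.
pose c2 := Num.max c1 (sup S).
have c20 : c2 < c0 by rewrite gt_max c01.
have c12 : c1 <= c2 by rewrite le_max lexx.
have S2 : sup S <= c2 by rewrite le_max lexx orbT.
have : S ((c2 + c0) / 2) by apply: c1P; lra.
by move=> /le_sup; lra.
Qed.

End Tipping.

Theorem proposition3p13 (R : realType) (p Gamma : R -> R)
    (p_BPUC : BPUC p)
    (p_pair : exists a r : R -> R, attractor_repeller_pair (fun=> 0) p a r)
    (Gamma_lim_ninfty : exists gm : R, Gamma t @[t --> -oo] --> gm)
    (Gamma_lim_pinfty : exists gp : R, Gamma t @[t --> +oo] --> gp)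
    (Gamma_derivable : forall t : R, derivable Gamma t 1)
    (Gamma_C1 : continuous (Gamma^`())%classic)
    (Gamma_nondecreasing : {homo Gamma : s t / s <= t})
    (Gamma_nonconstant : ~ exists g : R, forall t : R, Gamma t = g) :
  exists chat : R,
    unique (tipping_value (shifted_Q Gamma) (shifted_P Gamma p)) chat /\
    0 < chat.
Proof.
have [q [g [L [qb q_lip gc gb qd]]]] := forcing_splitting p p_BPUC.
have qc := continuous_lipschitz L q_lip.
pose dG := (Gamma^`())%classic.
have Gd (t : R) : is_derive t 1 Gamma (dG t).
  by rewrite /dG derive1E; exact: derivableP.
have dG_ge0 t : 0 <= dG t := is_derive_nondecreasing_ge0 _ _ _ Gamma_nondecreasing (Gd t).
have Gb : bounded Gamma.
  have [gm Gm] := Gamma_lim_ninfty; have [gp Gp] := Gamma_lim_pinfty.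
  exact: bounded_of_limits Gm Gp.
have [s [t Gst]] : exists s t, Gamma s < Gamma t.
  apply: contrapT => nlt; apply: Gamma_nonconstant; exists (Gamma 0) => t.
  apply/eqP; rewrite eq_le !leNgt; apply/andP; split; apply/negP => h.
    by apply: nlt; exists 0, t.
  by apply: nlt; exists t, 0.
have caseE := caseAE qb q_lip gc gb qd Gd Gb.
(* Repellers are attractors of the time-reversed data. *)
have bounded_flip (f : R -> R) : bounded f -> bounded (fun t => f (- t)).
  by move=> [B fB]; exists B => u.
have rqc : continuous (fun t => - q (- t)).
  exact/continuous_opp/continuous_flip.
have rqb : bounded (fun t => - q (- t)) by exact/bounded_opp/bounded_flip.
have rgc : continuous (fun t => g (- t)) by exact: continuous_flip.
have rgb : bounded (fun t => g (- t)) by exact: bounded_flip.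
have rGb : bounded (fun t => - Gamma (- t)) by exact/bounded_opp/bounded_flip.
have rGd (u : R) : is_derive u 1 (fun t => - Gamma (- t)) (dG (- u)).
  by have := is_derive_opp (is_derive_flip (Gd (- u))); rewrite opprK.
have rdG_ge0 u : 0 <= dG (- u) := dG_ge0 (- u).
have att_le := has_attractor_le qc qb gc gb Gd Gb dG_ge0.
have ratt_le := has_attractor_le rqc rqb rgc rgb rGd rGb rdG_ge0.
apply: unique_tipping_value => /=.
- have [a [r [_ _ ha hr]]] := p_pair.
  have Q0 : (fun=> 0) = shifted_Q Gamma 0.
    by apply/funext => u; rewrite /shifted_Q mul0r mulr0.
  have P0 : p = shifted_P Gamma p 0.
    by apply/funext => u; rewrite /shifted_P mul0r expr0n subr0.
  rewrite Q0 [X in attractive_hyperbolic _ X]P0 in ha.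
  rewrite Q0 [X in repulsive_hyperbolic _ X]P0 in hr.
  apply/caseE; split.
    by exists (fun t => a t - q t); apply/(attractive_hyperbolicE qb q_lip gc gb qd Gd Gb).
  by exists (fun t => - (r (- t) - q (- t)));
    apply/(repulsive_hyperbolicE qb q_lip gc gb qd Gd Gb).
- move=> c c' cc' /caseE[att ratt]; apply/caseE; split.
    exact: att_le att.
  exact: ratt_le ratt.
- move=> c /caseE[att ratt].
  have [e1 e10 att1] := has_attractor_open qc qb gc gb Gd Gb dG_ge0 c att.
  have [e2 e20 ratt2] := has_attractor_open rqc rqb rgc rgb rGd rGb rdG_ge0 c ratt.
  exists (Num.min e1 e2); first by rewrite lt_min e10.
  apply/caseE; split; [apply: att_le att1|apply: ratt_le ratt2];
    by rewrite lerD2l ge_min lexx ?orbT.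
- have [C CP] := attractor_parameter_bounded qb gb Gd Gb dG_ge0 s t Gst.
  by exists C => c /caseE[/CP].
Qed.
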